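(* If $\tilde{\mathcal{M}}$ is a holonomic family over a Noetherian scheme $B$ over $\mathbb{C}$, then the function $\beta\mapsto\operatorname{rank}(\mathcal{M}_\beta)$ is upper semi-continuous on both $B$ and on $B_{\mathbb{C}}$ (endowed with the subspace topology). In particular, the locus of rank-jumping points $\beta\in B_{\mathbb{C}}$ is closed in $B_{\mathbb{C}}$.
   Context: $D$ is the Weyl algebra over $\mathbb{C}$ in $x=x_1,\dots,x_n$ and $\partial_1,\dots,\partial_n$. For a $\mathbb{C}[x]$-module (or sheaf of $\mathbb{C}[x]$-modules) $N$ put $N(x)=\mathbb{C}(x)\otimes_{\mathbb{C}[x]}N$. For a scheme $B$ over $\mathbb{C}$ put $B(x)=\operatorname{Spec}\mathbb{C}(x)\times_{\operatorname{Spec}\mathbb{C}}B$ and $\mathcal{O}_B(x)=\mathbb{C}(x)\otimes_{\mathbb{C}}\mathcal{O}_B$. For $\beta\in B$ let $\kappa_\beta$ be the residue field; $B_{\mathbb{C}}\subseteq B$ is the set of closed points with residue field $\mathbb{C}$. A $D$-module $N$ is holonomic if it is a finitely generated left $D$-module with $\operatorname{Ext}^j_D(N,D)=0$ for $j\neq n$; its holonomic rank is $\operatorname{rank}(N)=\dim_{\mathbb{C}(x)}N(x)$. A coherent sheaf of left $(D\otimes_{\mathbb{C}}\mathcal{O}_B)$-modules is one that is quasi-coherent over $\mathcal{O}_B$ and whose sections over each affine open $U\subseteq B$ are finitely generated over the ring of global sections of $D\otimes_{\mathbb{C}}\mathcal{O}_U$. A holonomic family over $B$ is a coherent sheaf $\tilde{\mathcal{M}}$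 of left $(D\otimes_{\mathbb{C}}\mathcal{O}_B)$-modules whose fibers $\mathcal{M}_\beta=\tilde{\mathcal{M}}\otimes_{\mathcal{O}_B}\kappa_\beta$ are holonomic for all $\beta\in B$, and whose rank sheaf $\tilde{\mathcal{M}}(x)$ is coherent on the scheme $B(x)$. For $\beta$ with $\kappa_\beta\ne\mathbb{C}$, holonomicity and rank of $\mathcal{M}_\beta$ are understood over the Weyl algebra $D\otimes_{\mathbb{C}}\kappa_\beta$, i.e. $\operatorname{rank}(\mathcal{M}_\beta)=\dim_{\kappa_\beta(x)}\kappa_\beta(x)\otimes_{\kappa_\beta[x]}\mathcal{M}_\beta$ (the fiber dimension of $\tilde{\mathcal{M}}(x)$ at the point of $B(x)$ whose prime ideal is the extension of that of $\beta$). A point $\beta\in B$ is rank-jumping if (i) $\beta\in B_{\mathbb{C}}$, and (ii) for all open sets $U\subseteq B$ containing $\beta$, the rank of $\mathcal{M}_\beta$ is strictly greater than the minimal holonomic rank attained by any fiber $\mathcal{M}_{\beta'}$ with $\beta'\in U_{\mathbb{C}}=U\cap B_{\mathbb{C}}$. *)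

(* Defs.v *)
From HB Require Import structures.
(* The notations of multinomials clash with those of MathComp-Analysis, so
   K[x_1, ..., x_n] is written [mpoly n K] instead of {mpoly K[n]}. *)
From mathcomp Require Import -(notations) mpoly.
From mathcomp Require Import all_boot all_order all_algebra.
From mathcomp Require Import boolp classical_sets functions reals ereal.
From mathcomp Require Import topology normedtype.
From mathcomp Require Import complex ssrcomplements.

Set Implicit Arguments.
Unset Strict Implicit.
Unset Printing Implicit Defensive.
Import Order.TTheory GRing.Theory Num.Theory.

Local Open Scope classical_set_scope.
Local Open Scope ring_scope.

Lemma morphD_zmod (U V : zmodType) (f : U -> V) :
  {morph f : x y / x + y} -> zmod_morphism f.
Proof. by move=> fD x y; apply/(addIr (f y)); rewrite -fD !subrK. Qed.

Record zmod_setoid := ZmodSetoid {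
  zs_sort :> Type;
  zs_eq : zs_sort -> zs_sort -> Prop;
  zs_zero : zs_sort;
  zs_opp : zs_sort -> zs_sort;
  zs_add : zs_sort -> zs_sort -> zs_sort;
  zs_refl : forall a, zs_eq a a;
  zs_sym : forall a b, zs_eq a b -> zs_eq b a;
  zs_trans : forall a b c, zs_eq a b -> zs_eq b c -> zs_eq a c;
  zs_eq_opp : forall a a', zs_eq a a' -> zs_eq (zs_opp a) (zs_opp a');
  zs_eq_add : forall a a' b b', zs_eq a a' -> zs_eq b b' ->
    zs_eq (zs_add a b) (zs_add a' b');
  zs_addA : forall a b c,
    zs_eq (zs_add a (zs_add b c)) (zs_add (zs_add a b) c);
  zs_addC : forall a b, zs_eq (zs_add a b) (zs_add b a);
  zs_add0 : forall a, zs_eq (zs_add zs_zero a) a;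
  zs_addN : forall a, zs_eq (zs_add (zs_opp a) a) zs_zero }.

Section ZmodQuotient.
Variable Z : zmod_setoid.

Let e (a b : {classic Z}) : bool := `[< @zs_eq Z a b >].
Let e_refl : reflexive e.
Proof. by move=> a; apply/asboolP/zs_refl. Qed.
Let e_sym : symmetric e.
Proof. by move=> a b; apply/asboolP/asboolP; apply: zs_sym. Qed.
Let e_trans : transitive e.
Proof.
by move=> b a c /asboolP ab /asboolP bc; apply/asboolP; apply: zs_trans ab bc.
Qed.
Canonical zs_equiv := EquivRel e e_refl e_sym e_trans.

Definition zquot : Type := {eq_quot zs_equiv}%qT.
HB.instance Definition _ := Choice.on zquot.

Definition zcls (a : Z) : zquot := (\pi_{eq_quot zs_equiv} (a : {classic Z}))%qT.
Definition zrepr (x : zquot) : Z := repr (x : {eq_quot zs_equiv}%qT).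

Lemma zreprK x : zcls (zrepr x) = x.
Proof. exact: reprK. Qed.

Lemma zclsP a b : zcls a = zcls b <-> zs_eq a b.
Proof.
split=> [ab|ab]; first by apply/asboolP/(eqmodP zs_equiv).
by apply/(eqmodP zs_equiv)/asboolP.
Qed.

Lemma zrepr_cls a : zs_eq (zrepr (zcls a)) a.
Proof. by apply/zclsP; rewrite zreprK. Qed.

Definition zq_opp (x : zquot) := zcls (zs_opp (zrepr x)).
Definition zq_add (x y : zquot) := zcls (zs_add (zrepr x) (zrepr y)).

Lemma zq_oppE a : zq_opp (zcls a) = zcls (zs_opp a).
Proof. by apply/zclsP/zs_eq_opp/zrepr_cls. Qed.
Lemma zq_addE a b : zq_add (zcls a) (zcls b) = zcls (zs_add a b).
Proof. by apply/zclsP/zs_eq_add; apply: zrepr_cls. Qed.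

Lemma zq_addA : associative zq_add.
Proof.
move=> x y z; rewrite -(zreprK x) -(zreprK y) -(zreprK z) !zq_addE.
exact/zclsP/zs_addA.
Qed.
Lemma zq_addC : commutative zq_add.
Proof.
move=> x y; rewrite -(zreprK x) -(zreprK y) !zq_addE; exact/zclsP/zs_addC.
Qed.
Lemma zq_add0 : left_id (zcls (zs_zero Z)) zq_add.
Proof. move=> x; rewrite -(zreprK x) !zq_addE; exact/zclsP/zs_add0. Qed.
Lemma zq_addN : left_inverse (zcls (zs_zero Z)) zq_opp zq_add.
Proof. move=> x; rewrite -(zreprK x) zq_oppE zq_addE; exact/zclsP/zs_addN. Qed.

HB.instance Definition _ :=
  GRing.isZmodule.Build zquot zq_addA zq_addC zq_add0 zq_addN.

Lemma zcls0 : zcls (zs_zero Z) = 0. Proof. by []. Qed.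
Lemma zclsN a : zcls (zs_opp a) = - zcls a.
Proof. by rewrite -zq_oppE. Qed.
Lemma zclsD a b : zcls (zs_add a b) = zcls a + zcls b.
Proof. by rewrite -zq_addE. Qed.

End ZmodQuotient.

Record ring_setoid := RingSetoid {
  rs_zmod :> zmod_setoid;
  rs_one : rs_zmod;
  rs_mul : rs_zmod -> rs_zmod -> rs_zmod;
  rs_eq_mul : forall a a' b b', zs_eq a a' -> zs_eq b b' ->
    zs_eq (rs_mul a b) (rs_mul a' b');
  rs_mulA : forall a b c,
    zs_eq (rs_mul a (rs_mul b c)) (rs_mul (rs_mul a b) c);
  rs_mul1l : forall a, zs_eq (rs_mul rs_one a) a;
  rs_mul1r : forall a, zs_eq (rs_mul a rs_one) a;
  rs_mulDl : forall a b c,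
    zs_eq (rs_mul (zs_add a b) c) (zs_add (rs_mul a c) (rs_mul b c));
  rs_mulDr : forall a b c,
    zs_eq (rs_mul a (zs_add b c)) (zs_add (rs_mul a b) (rs_mul a c)) }.

Section RingQuotient.
Variable A : ring_setoid.

Definition rquot : Type := zquot A.
HB.instance Definition _ := GRing.Zmodule.on rquot.

Definition rq_mul (x y : rquot) : rquot := zcls (rs_mul (zrepr x) (zrepr y)).

Lemma rq_mulE (a b : A) : rq_mul (zcls a) (zcls b) = zcls (rs_mul a b).
Proof. by apply/zclsP/rs_eq_mul; apply: zrepr_cls. Qed.

Lemma rq_mulA : associative rq_mul.
Proof.
move=> x y z; rewrite -(zreprK x) -(zreprK y) -(zreprK z) !rq_mulE.
exact/zclsP/rs_mulA.
Qed.
Lemma rq_mul1l : left_id (zcls (rs_one A) : rquot) rq_mul.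
Proof. move=> x; rewrite -(zreprK x) rq_mulE; exact/zclsP/rs_mul1l. Qed.
Lemma rq_mul1r : right_id (zcls (rs_one A) : rquot) rq_mul.
Proof. move=> x; rewrite -(zreprK x) rq_mulE; exact/zclsP/rs_mul1r. Qed.
Lemma rq_mulDl : left_distributive rq_mul +%R.
Proof.
move=> x y z; rewrite -(zreprK x) -(zreprK y) -(zreprK z) -zclsD !rq_mulE -zclsD.
exact/zclsP/rs_mulDl.
Qed.
Lemma rq_mulDr : right_distributive rq_mul +%R.
Proof.
move=> x y z; rewrite -(zreprK x) -(zreprK y) -(zreprK z) -zclsD !rq_mulE -zclsD.
exact/zclsP/rs_mulDr.
Qed.

HB.instance Definition _ := GRing.Zmodule_isPzRing.Build rquot
  rq_mulA rq_mul1l rq_mul1r rq_mulDl rq_mulDr.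

Definition rcls (a : A) : rquot := zcls a.

Lemma rcls1 : rcls (rs_one A) = 1. Proof. by []. Qed.
Lemma rclsM a b : rcls (rs_mul a b) = rcls a * rcls b.
Proof. exact: (esym (rq_mulE a b)). Qed.

End RingQuotient.

Section ComRingQuotient.
Variables (A : ring_setoid).
Hypothesis AC : forall a b : A, zs_eq (rs_mul a b) (rs_mul b a).

Definition crquot of (forall a b : A, zs_eq (rs_mul a b) (rs_mul b a)) : Type :=
  rquot A.
Local Notation Q := (crquot AC).
HB.instance Definition _ := GRing.PzRing.on Q.

Lemma crq_mulC : commutative (@GRing.mul Q).
Proof.
move=> x y; rewrite -(zreprK x) -(zreprK y).
by rewrite -[LHS](@rclsM A) -[RHS](@rclsM A); apply/(@zclsP A)/AC.
Qed.
HB.instance Definition _ := GRing.PzRing_hasCommutativeMul.Build Q crq_mulC.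

End ComRingQuotient.

Record mod_setoid (S : pzRingType) := ModSetoid {
  ms_zmod :> zmod_setoid;
  ms_scale : S -> ms_zmod -> ms_zmod;
  ms_eq_scale : forall a m m', zs_eq m m' -> zs_eq (ms_scale a m) (ms_scale a m');
  ms_scaleA : forall a b m,
    zs_eq (ms_scale a (ms_scale b m)) (ms_scale (a * b) m);
  ms_scale1 : forall m, zs_eq (ms_scale 1 m) m;
  ms_scaleDr : forall a m m',
    zs_eq (ms_scale a (zs_add m m')) (zs_add (ms_scale a m) (ms_scale a m'));
  ms_scaleDl : forall a b m,
    zs_eq (ms_scale (a + b) m) (zs_add (ms_scale a m) (ms_scale b m)) }.

Section ModQuotient.
Variables (S : pzRingType) (M : mod_setoid S).

Definition mquot : Type := zquot M.
HB.instance Definition _ := GRing.Zmodule.on mquot.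

Definition mq_scale (a : S) (x : mquot) : mquot := zcls (ms_scale a (zrepr x)).

Lemma mq_scaleE a (m : M) : mq_scale a (zcls m) = zcls (ms_scale a m).
Proof. by apply/zclsP/ms_eq_scale/zrepr_cls. Qed.

Lemma mq_scaleA a b x : mq_scale a (mq_scale b x) = mq_scale (a * b) x.
Proof. rewrite -(zreprK x) !mq_scaleE; exact/zclsP/ms_scaleA. Qed.
Lemma mq_scale1 : left_id 1 mq_scale.
Proof. move=> x; rewrite -(zreprK x) !mq_scaleE; exact/zclsP/ms_scale1. Qed.
Lemma mq_scaleDr : right_distributive mq_scale +%R.
Proof.
move=> a x y; rewrite -(zreprK x) -(zreprK y) -zclsD !mq_scaleE -zclsD.
exact/zclsP/ms_scaleDr.
Qed.
Lemma mq_scaleDl x : {morph mq_scale^~ x : a b / a + b}.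
Proof.
move=> a b; rewrite -(zreprK x) /= !mq_scaleE -zclsD.
exact/zclsP/ms_scaleDl.
Qed.

HB.instance Definition _ := GRing.Zmodule_isLmodule.Build S mquot
  mq_scaleA mq_scale1 mq_scaleDr mq_scaleDl.

Definition mcls (m : M) : mquot := zcls m.

Lemma mclsZ a m : mcls (ms_scale a m) = a *: mcls m.
Proof. exact: (esym (mq_scaleE a m)). Qed.

End ModQuotient.

Inductive rterm (G : Type) : Type :=
| RGen of G | RZero | ROne | ROpp of rterm G
| RAdd of rterm G & rterm G | RMul of rterm G & rterm G.
Arguments RZero {G}.
Arguments ROne {G}.

Section PresentedRing.
Variables (G : Type) (rel : rterm G -> rterm G -> Prop).

Inductive rcong : rterm G -> rterm G -> Prop :=
| rc_rel t u of rel t u : rcong t u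
| rc_refl t : rcong t t
| rc_sym t u of rcong t u : rcong u t
| rc_trans t u v of rcong t u & rcong u v : rcong t v
| rc_opp t t' of rcong t t' : rcong (ROpp t) (ROpp t')
| rc_add t t' u u' of rcong t t' & rcong u u' : rcong (RAdd t u) (RAdd t' u')
| rc_mul t t' u u' of rcong t t' & rcong u u' : rcong (RMul t u) (RMul t' u')
| rc_addA t u v : rcong (RAdd t (RAdd u v)) (RAdd (RAdd t u) v)
| rc_addC t u : rcong (RAdd t u) (RAdd u t)
| rc_add0 t : rcong (RAdd RZero t) t
| rc_addN t : rcong (RAdd (ROpp t) t) RZero
| rc_mulA t u v : rcong (RMul t (RMul u v)) (RMul (RMul t u) v)
| rc_mul1l t : rcong (RMul ROne t) t
| rc_mul1r t : rcong (RMul t ROne) t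
| rc_mulDl t u v : rcong (RMul (RAdd t u) v) (RAdd (RMul t v) (RMul u v))
| rc_mulDr t u v : rcong (RMul t (RAdd u v)) (RAdd (RMul t u) (RMul t v)).

Definition pres_setoid : ring_setoid :=
  @RingSetoid (@ZmodSetoid (rterm G) rcong RZero (@ROpp G) (@RAdd G)
      rc_refl rc_sym rc_trans rc_opp rc_add rc_addA rc_addC rc_add0 rc_addN)
    ROne (@RMul G) rc_mul rc_mulA rc_mul1l rc_mul1r rc_mulDl rc_mulDr.

Definition pres_ring : pzRingType := rquot pres_setoid.

Definition pres_cls (t : rterm G) : pres_ring := @rcls pres_setoid t.
Definition pres_gen (g : G) : pres_ring := pres_cls (RGen g).

Lemma pres_clsP t u : rcong t u -> pres_cls t = pres_cls u.
Proof. by move=> h; apply/(@zclsP pres_setoid). Qed.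
Lemma pres_rel t u : rel t u -> pres_cls t = pres_cls u.
Proof. by move=> h; apply/pres_clsP/rc_rel. Qed.
Lemma pres_cls0 : pres_cls RZero = 0. Proof. by []. Qed.
Lemma pres_cls1 : pres_cls ROne = 1. Proof. by []. Qed.
Lemma pres_clsN t : pres_cls (ROpp t) = - pres_cls t.
Proof. exact: (@zclsN pres_setoid). Qed.
Lemma pres_clsD t u : pres_cls (RAdd t u) = pres_cls t + pres_cls u.
Proof. exact: (@zclsD pres_setoid). Qed.
Lemma pres_clsM t u : pres_cls (RMul t u) = pres_cls t * pres_cls u.
Proof. exact: (@rclsM pres_setoid). Qed.
Definition pres_clsE := (pres_cls0, pres_cls1, pres_clsN, pres_clsD, pres_clsM).

Section Lift.
Variables (S : pzRingType) (f : G -> S).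

Fixpoint reval (t : rterm G) : S :=
  match t with
  | RGen g => f g | RZero => 0 | ROne => 1 | ROpp t => - reval t
  | RAdd t u => reval t + reval u | RMul t u => reval t * reval u
  end.

Hypothesis fP : forall t u, rel t u -> reval t = reval u.

Lemma reval_cong t u : rcong t u -> reval t = reval u.
Proof.
elim=> /= *; do ?[exact: fP | congruence].
- by rewrite addrA.
- by rewrite addrC.
- by rewrite add0r.
- by rewrite addNr.
- by rewrite mulrA.
- by rewrite mul1r.
- by rewrite mulr1.
- by rewrite mulrDl.
- by rewrite mulrDr.
Qed.

Definition pres_lift of (forall t u, rel t u -> reval t = reval u) :
  pres_ring -> S := fun x => reval (@zrepr pres_setoid x).
Local Notation F := (pres_lift fP).

Lemma pres_lift_cls t : F (pres_cls t) = reval t.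
Proof. exact/reval_cong/(@zrepr_cls pres_setoid). Qed.

Lemma pres_lift_gen g : F (pres_gen g) = f g.
Proof. exact: pres_lift_cls. Qed.

Lemma pres_lift_zmod : zmod_morphism F.
Proof.
move=> x y; rewrite -(@zreprK pres_setoid x) -(@zreprK pres_setoid y).
rewrite -!/(pres_cls _) -pres_clsN -pres_clsD.
by rewrite ![F (pres_cls _)]pres_lift_cls.
Qed.
Lemma pres_lift_monoid : monoid_morphism F.
Proof.
split=> [|x y]; first by rewrite -pres_cls1 pres_lift_cls.
rewrite -(@zreprK pres_setoid x) -(@zreprK pres_setoid y).
rewrite -!/(pres_cls _) -pres_clsM.
by rewrite ![F (pres_cls _)]pres_lift_cls.
Qed.
HB.instance Definition _ :=
  GRing.isZmodMorphism.Build pres_ring S F pres_lift_zmod.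
HB.instance Definition _ :=
  GRing.isMonoidMorphism.Build pres_ring S F pres_lift_monoid.
End Lift.

End PresentedRing.

Inductive mterm (S G : Type) : Type :=
| MGen of G | MZero | MOpp of mterm S G
| MAdd of mterm S G & mterm S G | MScale of S & mterm S G.
Arguments MGen {S G}.
Arguments MZero {S G}.
Arguments MScale {S G}.

Section PresentedModule.
Variables (S : pzRingType) (G : Type) (rel : mterm S G -> mterm S G -> Prop).

Inductive mcong : mterm S G -> mterm S G -> Prop :=
| mc_rel t u of rel t u : mcong t u
| mc_refl t : mcong t t
| mc_sym t u of mcong t u : mcong u t
| mc_trans t u v of mcong t u & mcong u v : mcong t v
| mc_opp t t' of mcong t t' : mcong (MOpp t) (MOpp t')
| mc_add t t' u u' of mcong t t' & mcong u u' : mcong (MAdd t u) (MAdd t' u')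
| mc_scale a t t' of mcong t t' : mcong (MScale a t) (MScale a t')
| mc_addA t u v : mcong (MAdd t (MAdd u v)) (MAdd (MAdd t u) v)
| mc_addC t u : mcong (MAdd t u) (MAdd u t)
| mc_add0 t : mcong (MAdd MZero t) t
| mc_addN t : mcong (MAdd (MOpp t) t) MZero
| mc_scaleA a b t : mcong (MScale a (MScale b t)) (MScale (a * b) t)
| mc_scale1 t : mcong (MScale 1 t) t
| mc_scaleDr a t u : mcong (MScale a (MAdd t u)) (MAdd (MScale a t) (MScale a u))
| mc_scaleDl a b t : mcong (MScale (a + b) t) (MAdd (MScale a t) (MScale b t)).

Definition pres_mod_setoid : mod_setoid S :=
  @ModSetoid S (@ZmodSetoid (mterm S G) mcong MZero (@MOpp S G) (@MAdd S G)
      mc_refl mc_sym mc_trans mc_opp mc_add mc_addA mc_addC mc_add0 mc_addN)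
    MScale mc_scale mc_scaleA mc_scale1 mc_scaleDr mc_scaleDl.

Definition pres_mod : lmodType S := mquot pres_mod_setoid.

Definition pres_mod_gen (g : G) : pres_mod := @mcls S pres_mod_setoid (MGen g).

End PresentedModule.

Section Restriction.
Variables (P S : pzRingType) (f : {rmorphism P -> S}) (M : lmodType S).

Definition restrict of {rmorphism P -> S} : Type := M.
Local Notation Mf := (restrict f).
HB.instance Definition _ := GRing.Zmodule.on Mf.

Definition restrict_scale (a : P) (m : Mf) : Mf := f a *: (m : M).

Lemma restrict_scaleA a b m :
  restrict_scale a (restrict_scale b m) = restrict_scale (a * b) m.
Proof. by rewrite /restrict_scale rmorphM scalerA. Qed.
Lemma restrict_scale1 : left_id 1 restrict_scale.
Proof. by move=> m; rewrite /restrict_scale rmorph1 scale1r. Qed.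
Lemma restrict_scaleDr : right_distributive restrict_scale +%R.
Proof. by move=> a m m'; rewrite /restrict_scale scalerDr. Qed.
Lemma restrict_scaleDl m : {morph restrict_scale^~ m : a b / a + b}.
Proof. by move=> a b; rewrite /restrict_scale rmorphD scalerDl. Qed.
HB.instance Definition _ := GRing.Zmodule_isLmodule.Build P Mf
  restrict_scaleA restrict_scale1 restrict_scaleDr restrict_scaleDl.
End Restriction.

(* S (x)_P M, the generator m standing for 1 (x) m *)
Section Extension.
Variables (P S : pzRingType) (f : {rmorphism P -> S}) (M : lmodType P).

Inductive extend_rel : mterm S M -> mterm S M -> Prop :=
| ext_add m m' : extend_rel (MGen (m + m')) (MAdd (MGen m) (MGen m'))
| ext_scale a m : extend_rel (MGen (a *: m)) (MScale (f a) (MGen m)).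

Definition extend : lmodType S := pres_mod extend_rel.
End Extension.

(* A (x)_k B for k-algebras A and B, generated by the symbols L a = a (x) 1 and
   R b = 1 (x) b *)
Section Tensor.
Variables (k : comPzRingType) (A B : pzRingType).
Variables (iA : {rmorphism k -> A}) (iB : {rmorphism k -> B}).

Local Notation L a := (RGen (inl a : A + B)).
Local Notation R b := (RGen (inr b : A + B)).

Inductive tens_rel : rterm (A + B) -> rterm (A + B) -> Prop :=
| tens_l1 : tens_rel (L 1) ROne
| tens_lD a a' : tens_rel (L (a + a')) (RAdd (L a) (L a'))
| tens_lM a a' : tens_rel (L (a * a')) (RMul (L a) (L a'))
| tens_r1 : tens_rel (R 1) ROne
| tens_rD b b' : tens_rel (R (b + b')) (RAdd (R b) (R b'))
| tens_rM b b' : tens_rel (R (b * b')) (RMul (R b) (R b'))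
| tens_comm a b : tens_rel (RMul (L a) (R b)) (RMul (R b) (L a))
| tens_base c : tens_rel (L (iA c)) (R (iB c)).

Definition tens : pzRingType := pres_ring tens_rel.

Definition tens_l (a : A) : tens := pres_gen tens_rel (inl a).
Definition tens_r (b : B) : tens := pres_gen tens_rel (inr b).

Lemma tens_l_add : {morph tens_l : x y / x + y}.
Proof. by move=> a b; rewrite -pres_clsD; apply/pres_rel; constructor. Qed.
Lemma tens_l_zmod : zmod_morphism tens_l.
Proof. exact/morphD_zmod/tens_l_add. Qed.
Lemma tens_l_monoid : monoid_morphism tens_l.
Proof.
by split=> [|a b]; [rewrite -pres_cls1|rewrite -pres_clsM];
  apply/pres_rel; constructor.
Qed.
HB.instance Definition _ := GRing.isZmodMorphism.Build A tens tens_l tens_l_zmod.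
HB.instance Definition _ :=
  GRing.isMonoidMorphism.Build A tens tens_l tens_l_monoid.

Lemma tens_r_add : {morph tens_r : x y / x + y}.
Proof. by move=> a b; rewrite -pres_clsD; apply/pres_rel; constructor. Qed.
Lemma tens_r_zmod : zmod_morphism tens_r.
Proof. exact/morphD_zmod/tens_r_add. Qed.
Lemma tens_r_monoid : monoid_morphism tens_r.
Proof.
by split=> [|a b]; [rewrite -pres_cls1|rewrite -pres_clsM];
  apply/pres_rel; constructor.
Qed.
HB.instance Definition _ := GRing.isZmodMorphism.Build B tens tens_r tens_r_zmod.
HB.instance Definition _ :=
  GRing.isMonoidMorphism.Build B tens tens_r tens_r_monoid.

Lemma tens_lr_comm a b : tens_l a * tens_r b = tens_r b * tens_l a.
Proof. by rewrite -!pres_clsM; apply/pres_rel; constructor. Qed.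
Lemma tens_baseE c : tens_l (iA c) = tens_r (iB c).
Proof. by apply/pres_rel; constructor. Qed.

Section TensorLift.
Variables (S : pzRingType) (f : {rmorphism A -> S}) (g : {rmorphism B -> S}).
Hypothesis fg_comm : forall a b, f a * g b = g b * f a.
Hypothesis fg_base : forall c, f (iA c) = g (iB c).

Definition tens_fun (x : A + B) : S :=
  match x with inl a => f a | inr b => g b end.

Lemma tens_funP t u : tens_rel t u -> reval tens_fun t = reval tens_fun u.
Proof. by case=> /= *; rewrite ?rmorph1 ?rmorphD ?rmorphM. Qed.

Definition tens_lift : {rmorphism tens -> S} := pres_lift tens_funP.

Lemma tens_lift_l a : tens_lift (tens_l a) = f a.
Proof. exact: (pres_lift_gen tens_funP). Qed.
Lemma tens_lift_r b : tens_lift (tens_r b) = g b.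
Proof. exact: (pres_lift_gen tens_funP). Qed.
End TensorLift.

End Tensor.

Section TensorMap.
Variables (k : comPzRingType) (A B A' B' : pzRingType).
Variables (iA : {rmorphism k -> A}) (iB : {rmorphism k -> B}).
Variables (iA' : {rmorphism k -> A'}) (iB' : {rmorphism k -> B'}).
Variables (f : {rmorphism A -> A'}) (g : {rmorphism B -> B'}).
Hypothesis fP : forall c, f (iA c) = iA' c.
Hypothesis gP : forall c, g (iB c) = iB' c.

Let l : {rmorphism A -> tens iA' iB'} := (tens_l iA' iB' \o f)%FUN.
Let r : {rmorphism B -> tens iA' iB'} := (tens_r iA' iB' \o g)%FUN.
Let lr_comm a b : l a * r b = r b * l a.
Proof. exact: tens_lr_comm. Qed.
Let lr_base c : l (iA c) = r (iB c).
Proof. by rewrite /l /r /= fP gP tens_baseE. Qed.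

Definition tens_map : {rmorphism tens iA iB -> tens iA' iB'} :=
  tens_lift lr_comm lr_base.
End TensorMap.

Record opens (X : topologicalType) := Opens {
  opens_set :> set X;
  opens_open : open opens_set }.

Definition opensT (X : topologicalType) : opens X := Opens (@openT X).
Definition opensI (X : topologicalType) (U V : opens X) : opens X :=
  Opens (openI (opens_open U) (opens_open V)).

Lemma opensIl (X : topologicalType) (U V : opens X) : opensI U V `<=` U.
Proof. exact: subIsetl. Qed.
Lemma opensIr (X : topologicalType) (U V : opens X) : opensI U V `<=` V.
Proof. exact: subIsetr. Qed.

Record ring_sheaf (X : topologicalType) := RingSheaf {
  sec : opens X -> comPzRingType;
  res : forall U V : opens X, V `<=` U -> {rmorphism sec U -> sec V};
  res_id : forall (U : opens X) (UU : U `<=` U) (s : sec U), res UU s = s;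
  res_comp : forall (U V W : opens X) (VU : V `<=` U) (WV : W `<=` V)
      (WU : W `<=` U) (s : sec U),
    res WV (res VU s) = res WU s;
  sec_glue : forall (U : opens X) (I : Type) (V : I -> opens X)
      (VU : forall i, V i `<=` U),
    U `<=` \bigcup_i V i ->
    forall s : forall i, sec (V i),
    (forall i j, res (@opensIl _ (V i) (V j)) (s i)
               = res (@opensIr _ (V i) (V j)) (s j)) ->
    exists! t : sec U, forall i, res (VU i) t = s i }.

Section Stalk.
Variables (X : topologicalType) (O : ring_sheaf X) (x : X).

Record germ := Germ {
  germ_dom : opens X;
  germ_mem : opens_set germ_dom x;
  germ_sec : sec O germ_dom }.

Definition germ_eq (s t : germ) := exists (W : opens X)
  (Ws : W `<=` germ_dom s) (Wt : W `<=` germ_dom t),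
  opens_set W x /\ res O Ws (germ_sec s) = res O Wt (germ_sec t).

Definition germ_cst (c : sec O (opensT X)) : germ :=
  @Germ (opensT X) I c.
Definition germ_opp (s : germ) : germ := Germ (germ_mem s) (- germ_sec s).
Definition germ_op2 (op : forall U, sec O U -> sec O U -> sec O U) (s t : germ) :
    germ :=
  @Germ (opensI (germ_dom s) (germ_dom t)) (conj (germ_mem s) (germ_mem t))
    (op _ (res O (@opensIl _ _ _) (germ_sec s))
          (res O (@opensIr _ _ _) (germ_sec t))).
Definition germ_add := germ_op2 (fun U => +%R).
Definition germ_mul := germ_op2 (fun U => *%R).

Lemma germ_eqP (s t : germ) (W : opens X) (Ws : W `<=` germ_dom s)
    (Wt : W `<=` germ_dom t) :
  opens_set W x -> res O Ws (germ_sec s) = res O Wt (germ_sec t) -> germ_eq s t.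
Proof. by move=> Wx st; exists W, Ws, Wt. Qed.

Lemma res_irr (U V : opens X) (VU VU' : V `<=` U) (s : sec O U) :
  res O VU s = res O VU' s.
Proof. by rewrite (Prop_irrelevance VU VU'). Qed.

Lemma res_res (U V W : opens X) (VU : V `<=` U) (WV : W `<=` V) (s : sec O U) :
  res O WV (res O VU s) = res O (subset_trans WV VU) s.
Proof. exact: res_comp. Qed.

Lemma germ_refl s : germ_eq s s.
Proof. exact: (@germ_eqP s s _ (@subset_refl _ _) (@subset_refl _ _) (germ_mem s)). Qed.
Lemma germ_sym s t : germ_eq s t -> germ_eq t s.
Proof. by move=> [W [Ws [Wt [Wx st]]]]; exists W, Wt, Ws. Qed.

Lemma germ_trans s t u : germ_eq s t -> germ_eq t u -> germ_eq s u.
Proof.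
move=> [W [Ws [Wt [Wx st]]]] [V [Vt [Vu [Vx tu]]]].
have IW : opensI W V `<=` W by exact: opensIl.
have IV : opensI W V `<=` V by exact: opensIr.
apply: (@germ_eqP s u (opensI W V) (subset_trans IW Ws) (subset_trans IV Vu)) => //.
by rewrite -!res_res st -tu !res_res; apply: res_irr.
Qed.

Lemma germ_opp_eq s s' : germ_eq s s' -> germ_eq (germ_opp s) (germ_opp s').
Proof.
by move=> [W [Ws [Wt [Wx st]]]]; exists W, Ws, Wt; split; rewrite // !rmorphN st.
Qed.

Lemma germ_op2_eq (op : forall U, sec O U -> sec O U -> sec O U)
    (s s' t t' : germ) :
  (forall (U V : opens X) (VU : V `<=` U) a b,
     res O VU (op U a b) = op V (res O VU a) (res O VU b)) ->
  germ_eq s s' -> germ_eq t t' -> germ_eq (germ_op2 op s t) (germ_op2 op s' t').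
Proof.
move=> opE [W [Ws [Ws' [Wx ss']]]] [V [Vt [Vt' [Vx tt']]]].
have IW : opensI W V `<=` W by exact: opensIl.
have IV : opensI W V `<=` V by exact: opensIr.
have I1 : opensI W V `<=` opensI (germ_dom s) (germ_dom t).
  by move=> y [/Ws ? /Vt].
have I2 : opensI W V `<=` opensI (germ_dom s') (germ_dom t').
  by move=> y [/Ws' ? /Vt'].
apply: (@germ_eqP (germ_op2 op s t) (germ_op2 op s' t') _ I1 I2) => //=.
have es := congr1 (res O IW) ss'; have et := congr1 (res O IV) tt'.
rewrite !res_res in es et; rewrite !opE !res_res.
congr (op _ _ _).
- apply: etrans (res_irr _ _ _) (etrans es (res_irr _ _ _)).
- apply: etrans (res_irr _ _ _) (etrans et (res_irr _ _ _)).
Qed.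

Ltac germ_axiom :=
  match goal with |- germ_eq ?s ?t =>
    let W := constr:(opensI (germ_dom s) (germ_dom t)) in
    apply: (@germ_eqP s t W (@opensIl _ _ _) (@opensIr _ _ _));
      [by split; apply: germ_mem
      | rewrite /= ?(rmorphD, rmorphM, rmorphN, rmorph0, rmorph1) /=
                   ?(rmorphD, rmorphM, rmorphN, rmorph0, rmorph1) ?res_res]
  end.

Lemma germ_addA s t u :
  germ_eq (germ_add s (germ_add t u)) (germ_add (germ_add s t) u).
Proof. by germ_axiom; rewrite addrA; congr (_ + _ + _); apply: res_irr. Qed.
Lemma germ_addC s t : germ_eq (germ_add s t) (germ_add t s).
Proof. by germ_axiom; rewrite addrC; congr (_ + _); apply: res_irr. Qed.
Lemma germ_add0 s : germ_eq (germ_add (germ_cst 0) s) s.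
Proof. by germ_axiom; rewrite add0r; apply: res_irr. Qed.
Lemma germ_addN s : germ_eq (germ_add (germ_opp s) s) (germ_cst 0).
Proof.
by germ_axiom; apply/eqP; rewrite addrC subr_eq0; apply/eqP/res_irr.
Qed.
Lemma germ_mulA s t u :
  germ_eq (germ_mul s (germ_mul t u)) (germ_mul (germ_mul s t) u).
Proof. by germ_axiom; rewrite mulrA; congr (_ * _ * _); apply: res_irr. Qed.
Lemma germ_mulC s t : germ_eq (germ_mul s t) (germ_mul t s).
Proof. by germ_axiom; rewrite mulrC; congr (_ * _); apply: res_irr. Qed.
Lemma germ_mul1l s : germ_eq (germ_mul (germ_cst 1) s) s.
Proof. by germ_axiom; rewrite mul1r; apply: res_irr. Qed.
Lemma germ_mul1r s : germ_eq (germ_mul s (germ_cst 1)) s.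
Proof. by germ_axiom; rewrite mulr1; apply: res_irr. Qed.
Lemma germ_mulDl s t u :
  germ_eq (germ_mul (germ_add s t) u) (germ_add (germ_mul s u) (germ_mul t u)).
Proof.
by germ_axiom; rewrite mulrDl; congr (_ * _ + _ * _); apply: res_irr.
Qed.
Lemma germ_mulDr s t u :
  germ_eq (germ_mul s (germ_add t u)) (germ_add (germ_mul s t) (germ_mul s u)).
Proof.
by germ_axiom; rewrite mulrDr; congr (_ * _ + _ * _); apply: res_irr.
Qed.
Lemma germ_add_eq s s' t t' :
  germ_eq s s' -> germ_eq t t' -> germ_eq (germ_add s t) (germ_add s' t').
Proof. by apply: germ_op2_eq => U V VU a b; rewrite rmorphD. Qed.
Lemma germ_mul_eq s s' t t' :
  germ_eq s s' -> germ_eq t t' -> germ_eq (germ_mul s t) (germ_mul s' t').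
Proof. by apply: germ_op2_eq => U V VU a b; rewrite rmorphM. Qed.

Definition germ_setoid : ring_setoid :=
  @RingSetoid (@ZmodSetoid germ germ_eq (germ_cst 0) germ_opp germ_add
      germ_refl germ_sym germ_trans germ_opp_eq germ_add_eq
      germ_addA germ_addC germ_add0 germ_addN)
    (germ_cst 1) germ_mul germ_mul_eq germ_mulA germ_mul1l germ_mul1r
    germ_mulDl germ_mulDr.

Definition stalk : comPzRingType := @crquot germ_setoid germ_mulC.

Section ToStalk.
Variables (U : opens X) (Ux : opens_set U x).

Definition to_stalk (s : sec O U) : stalk :=
  @rcls germ_setoid (Germ Ux s).
Local Notation F := to_stalk.

Lemma to_stalk_zmod : zmod_morphism F.
Proof.
apply: morphD_zmod => s t; rewrite -[RHS](@zclsD germ_setoid).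
apply/(@zclsP germ_setoid) => /=; germ_axiom.
by congr (_ + _); apply: res_irr.
Qed.
Lemma to_stalk_monoid : monoid_morphism F.
Proof.
split=> [|s t]; last rewrite -[RHS](@rclsM germ_setoid);
  apply/(@zclsP germ_setoid) => /=; germ_axiom => //.
by congr (_ * _); apply: res_irr.
Qed.
HB.instance Definition _ :=
  GRing.isZmodMorphism.Build (sec O U) stalk F to_stalk_zmod.
HB.instance Definition _ :=
  GRing.isMonoidMorphism.Build (sec O U) stalk F to_stalk_monoid.
End ToStalk.

Lemma to_stalk_res (U V : opens X) (VU : V `<=` U) (Ux : opens_set U x)
    (Vx : opens_set V x) (s : sec O U) :
  to_stalk Vx (res O VU s) = to_stalk Ux s.
Proof.
by apply/(@zclsP germ_setoid) => /=; germ_axiom; apply: res_irr.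
Qed.

End Stalk.

Definition is_unit (A : comPzRingType) (a : A) := exists b, a * b = 1.

Definition is_local (A : comPzRingType) :=
  ~ is_unit (0 : A) /\
  forall a b : A, is_unit (a + b) -> is_unit a \/ is_unit b.

Section ResidueField.
Variables (A : comPzRingType) (hA : is_local A).

Definition res_eq (a b : A) := ~ is_unit (a - b).

Lemma nonunitD (a b : A) : ~ is_unit a -> ~ is_unit b -> ~ is_unit (a + b).
Proof. by move=> ha hb /(proj2 hA)[]. Qed.
Lemma nonunitM (a b : A) : ~ is_unit b -> ~ is_unit (a * b).
Proof. by move=> hb [c abc]; apply: hb; exists (a * c); rewrite mulrCA mulrA. Qed.
Lemma nonunitN (a : A) : ~ is_unit a -> ~ is_unit (- a).
Proof. by rewrite -mulN1r; apply: nonunitM. Qed.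

Lemma res_eq_refl a : res_eq a a.
Proof. by rewrite /res_eq subrr; case: hA. Qed.
Lemma res_eq_of a b : a = b -> res_eq a b.
Proof. by move=> ->; apply: res_eq_refl. Qed.
Lemma res_eq_sym a b : res_eq a b -> res_eq b a.
Proof. by move=> /nonunitN; rewrite opprB. Qed.
Lemma res_eq_trans a b c : res_eq a b -> res_eq b c -> res_eq a c.
Proof.
by move=> ab bc; have := nonunitD ab bc; rewrite addrA subrK.
Qed.
Lemma res_eq_opp a a' : res_eq a a' -> res_eq (- a) (- a').
Proof. by move=> /nonunitN; rewrite opprD. Qed.
Lemma res_eq_add a a' b b' :
  res_eq a a' -> res_eq b b' -> res_eq (a + b) (a' + b').
Proof. by move=> ha hb; have := nonunitD ha hb; rewrite addrACA -opprD. Qed.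
Lemma res_eq_mul a a' b b' :
  res_eq a a' -> res_eq b b' -> res_eq (a * b) (a' * b').
Proof.
move=> ha hb; apply: (@res_eq_trans _ (a * b')).
  by rewrite /res_eq -mulrBr; apply: nonunitM.
by rewrite /res_eq -mulrBl mulrC; apply: nonunitM.
Qed.

Definition res_setoid : ring_setoid :=
  @RingSetoid (@ZmodSetoid A res_eq 0 -%R +%R
      res_eq_refl res_eq_sym res_eq_trans res_eq_opp res_eq_add
      (fun a b c => res_eq_of (addrA a b c)) (fun a b => res_eq_of (addrC a b))
      (fun a => res_eq_of (add0r a)) (fun a => res_eq_of (addNr a)))
    1 *%R res_eq_mul
    (fun a b c => res_eq_of (mulrA a b c))
    (fun a => res_eq_of (mul1r a)) (fun a => res_eq_of (mulr1 a))
    (fun a b c => res_eq_of (mulrDl a b c))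
    (fun a b c => res_eq_of (mulrDr a b c)).

Definition residue : Type :=
  @crquot res_setoid (fun a b => res_eq_of (mulrC a b)).
Local Notation K := residue.
HB.instance Definition _ := GRing.ComPzRing.on K.

Definition to_residue (a : A) : K := @rcls res_setoid a.
Local Notation F := to_residue.

Lemma to_residue_zmod : zmod_morphism F.
Proof.
by apply: morphD_zmod => s t; rewrite -[RHS](@zclsD res_setoid).
Qed.
Lemma to_residue_monoid : monoid_morphism F.
Proof. by split=> // s t; rewrite -[RHS](@rclsM res_setoid). Qed.
HB.instance Definition _ := GRing.isZmodMorphism.Build A K F to_residue_zmod.
HB.instance Definition _ := GRing.isMonoidMorphism.Build A K F to_residue_monoid.

Lemma to_residue_surj (x : K) : exists a, x = F a.
Proof. by exists (@zrepr res_setoid x); rewrite -[LHS](@zreprK res_setoid). Qed.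
Lemma to_residueP a b : F a = F b <-> ~ is_unit (a - b).
Proof. exact: (@zclsP res_setoid). Qed.
Lemma to_residue_eq0 a : F a = 0 <-> ~ is_unit a.
Proof. by rewrite -(rmorph0 F) to_residueP subr0. Qed.

Lemma residue_neq0 : (1 : K) != 0.
Proof.
apply/eqP; rewrite -(rmorph1 F) => /to_residue_eq0; apply.
by exists 1; rewrite mulr1.
Qed.
HB.instance Definition _ := GRing.PzSemiRing_isNonZero.Build K residue_neq0.

Lemma residue_inv_ex (x : K) : exists y : K, if x == 0 then y = 0 else y * x = 1.
Proof.
case: eqP => [_|]; first by exists 0.
have [a ->] := to_residue_surj x.
move=> Fa0; have [b ab1] : is_unit a by apply: contrapT => /to_residue_eq0.
exists (F b).
by rewrite mulrC -rmorphM ab1 rmorph1.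
Qed.
Definition residue_inv (x : K) : K := projT1 (cid (residue_inv_ex x)).
Lemma residue_mulVf (x : K) : x != 0 -> residue_inv x * x = 1.
Proof.
by rewrite /residue_inv => /negPf x0; case: cid => y /=; rewrite x0.
Qed.
Lemma residue_inv0 : residue_inv 0 = 0.
Proof. by rewrite /residue_inv; case: cid => y /=; rewrite eqxx. Qed.
HB.instance Definition _ :=
  GRing.ComNzRing_isField.Build K residue_mulVf residue_inv0.

End ResidueField.

Lemma opens_subT (X : topologicalType) (U : opens X) : U `<=` opensT X.
Proof. exact: subsetT. Qed.

Lemma to_stalk_surj (X : topologicalType) (O : ring_sheaf X) (x : X)
    (b : stalk O x) :
  exists s : germ O x, b = to_stalk (germ_mem s) (germ_sec s).
Proof.
exists (@zrepr (germ_setoid O x) b); rewrite -[LHS](@zreprK (germ_setoid O x)).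
by rewrite /to_stalk; case: (@zrepr (germ_setoid O x) b).
Qed.

Record spectrum (A : comPzRingType) := PrimeIdeal {
  prime_set :> set A;
  prime0 : prime_set 0;
  primeD : forall a b, prime_set a -> prime_set b -> prime_set (a + b);
  primeMl : forall a b, prime_set b -> prime_set (a * b);
  prime1 : ~ prime_set 1;
  primeM : forall a b, prime_set (a * b) -> prime_set a \/ prime_set b }.

Section Zariski.
Variable A : comPzRingType.

HB.instance Definition _ := gen_eqMixin (spectrum A).
HB.instance Definition _ := gen_choiceMixin (spectrum A).

Definition spec_open : set_system (spectrum A) :=
  [set W | exists E : set A, W = [set p | exists2 f, E f & ~ prime_set p f]].

Lemma spec_openT : spec_open setT.
Proof.
exists [set 1]; apply/seteqP; split=> // p _; exists 1 => //; exact: prime1.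
Qed.

Lemma spec_openI : setI_closed spec_open.
Proof.
move=> _ _ [E ->] [F ->]; exists [set h | exists f g, [/\ E f, F g & h = f * g]].
apply/seteqP; split=> [p [[f Ef pf] [g Fg pg]]|p [_ [f [g [Ef Fg ->]]] pfg]] /=.
  by exists (f * g); [exists f, g|move=> /primeM[]].
split; [exists f => // pf | exists g => // pg]; apply: pfg; last exact: primeMl.
by rewrite mulrC; apply: primeMl.
Qed.

Lemma spec_open_bigU (I : Type) (W : I -> set (spectrum A)) :
  (forall i, spec_open (W i)) -> spec_open (\bigcup_i W i).
Proof.
move=> /choice[E WE]; exists (\bigcup_i E i).
apply/seteqP; split=> [p [i _]|p [f [i _ Ef] pf]].
  by rewrite WE => -[f Ef pf]; exists f => //; exists i.
by exists i => //; rewrite WE; exists f.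
Qed.

HB.instance Definition _ := isOpenTopological.Build (spectrum A)
  spec_openT spec_openI spec_open_bigU.
End Zariski.

(* [g : N -> N'] exhibits N' as the localization N_f of N at the powers of f,
   where [a] and [a'] are the multiplications by f on N and on N'. *)
Definition is_localization (N N' : zmodType) (a : N -> N) (a' : N' -> N')
    (g : N -> N') :=
  [/\ bijective a',
      forall y, exists m x, iter m a' y = g x
    & forall x, g x = 0 <-> exists m, iter m a x = 0].

Record lrspace (k : fieldType) := LRSpace {
  lrs_space :> topologicalType;
  lrs_sheaf : ring_sheaf lrs_space;
  lrs_str : {rmorphism k -> sec lrs_sheaf (opensT lrs_space)};
  lrs_local : forall x, is_local (stalk lrs_sheaf x) }.

Section LRSpaceTheory.
Variables (k : fieldType) (X : lrspace k).
Local Notation O := (sec (lrs_sheaf X)).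

Definition struct_map (U : opens X) : {rmorphism k -> O U} :=
  (res (lrs_sheaf X) (@opens_subT _ U) \o lrs_str X)%FUN.

Definition kappa (x : X) : fieldType := residue (lrs_local x).

Definition value (x : X) (U : opens X) (Ux : opens_set U x) :
    {rmorphism O U -> kappa x} :=
  (to_residue (lrs_local x) \o to_stalk Ux)%FUN.

Definition kappa_str (x : X) : {rmorphism k -> kappa x} :=
  (@value x (opensT X) I \o struct_map (opensT X))%FUN.

Lemma value_res (x : X) (U V : opens X) (VU : V `<=` U) (Ux : opens_set U x)
    (Vx : opens_set V x) (s : O U) :
  value Vx (res (lrs_sheaf X) VU s) = value Ux s.
Proof. by rewrite /value /= (to_stalk_res VU Ux Vx). Qed.

Lemma struct_map_res (U V : opens X) (VU : V `<=` U) c :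
  res (lrs_sheaf X) VU (struct_map U c) = struct_map V c.
Proof. exact: res_comp. Qed.

Lemma value_struct (x : X) (U : opens X) (Ux : opens_set U x) c :
  value Ux (struct_map U c) = kappa_str x c.
Proof.
have -> : kappa_str x c = @value x (opensT X) I (struct_map (opensT X) c) by [].
by rewrite -(value_res (@opens_subT _ U) I Ux) struct_map_res.
Qed.

Definition nonvanishing_set (U : opens X) (f : O U) : set X :=
  [set x | exists Ux : opens_set U x, value Ux f != 0].

Lemma nonvanishing_open (U : opens X) (f : O U) : open (nonvanishing_set f).
Proof.
rewrite openE => x [Ux fx]; rewrite /interior nbhsE.
have [b fb1] : is_unit (to_stalk Ux f).
  by apply: contrapT => nu; case/eqP: fx; apply/(to_residue_eq0 (lrs_local x)).
have [[V Vx t] bE] := to_stalk_surj b.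
have UVx : opens_set (opensI U V) x by split.
move: fb1; rewrite bE /= -(to_stalk_res (@opensIl _ U V) Ux UVx).
rewrite -(to_stalk_res (@opensIr _ U V) Vx UVx) -rmorphM.
rewrite -(rmorph1 (to_stalk (O := lrs_sheaf X) UVx)).
move=> /(@zclsP (germ_setoid _ _)) /= [W [WUV [WT [Wx]]]] /=.
rewrite rmorphM !rmorph1 !res_res => ft1.
exists W; first by split => //; exact: opens_open.
move=> y Wy; have Uy : opens_set U y by case: (WUV y Wy).
exists Uy; apply/eqP => fy0.
have := congr1 (@value y W Wy) ft1; rewrite rmorphM rmorph1.
rewrite (value_res _ Uy) fy0 mul0r => /esym/eqP.
by rewrite (negPf (oner_neq0 _)).
Qed.

Definition nonvanishing (U : opens X) (f : O U) : opens X :=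
  Opens (nonvanishing_open f).

Lemma nonvanishing_sub (U : opens X) (f : O U) : nonvanishing f `<=` U.
Proof. by move=> x []. Qed.

Section SpecMap.
Variable U : opens X.

Definition vanishing_ideal (x : opens_set U) : set (O U) :=
  [set f | value (set_valP x) f = 0].

Lemma vanishing_ideal0 x : vanishing_ideal x 0.
Proof. exact: rmorph0. Qed.
Lemma vanishing_idealD x f g :
  vanishing_ideal x f -> vanishing_ideal x g -> vanishing_ideal x (f + g).
Proof.
move=> fx gx; apply: etrans (rmorphD _ _ _) _.
by rewrite [X in X + _]fx [X in _ + X]gx addr0.
Qed.
Lemma vanishing_idealMl x f g :
  vanishing_ideal x g -> vanishing_ideal x (f * g).
Proof.
by move=> gx; apply: etrans (rmorphM _ _ _) _; rewrite [X in _ * X]gx mulr0.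
Qed.
Lemma vanishing_ideal1 x : ~ vanishing_ideal x 1.
Proof. by move=> /(etrans (esym (rmorph1 _)))/eqP; apply/negP/oner_neq0. Qed.
Lemma vanishing_idealM x f g : vanishing_ideal x (f * g) ->
  vanishing_ideal x f \/ vanishing_ideal x g.
Proof.
move=> /(etrans (esym (rmorphM _ _ _)))/eqP; rewrite mulf_eq0.
by case/orP=> /eqP; [left|right].
Qed.

Definition to_spec (x : opens_set U) : spectrum (O U) :=
  PrimeIdeal (vanishing_ideal0 x) (@vanishing_idealD x) (@vanishing_idealMl x)
    (@vanishing_ideal1 x) (@vanishing_idealM x).

(* The canonical morphism (U, O_U) -> Spec O(U) is an isomorphism: it is a
   homeomorphism, under which O_U is the structure sheaf of Spec O(U), i.e. the
   sheaf whose sections over D(f) are O(U)_f. *)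
Definition is_affine :=
  [/\ bijective to_spec, continuous to_spec,
      forall W, open W -> open (to_spec @` W)
    & forall f : O U, is_localization ( *%R f)
        ( *%R (res (lrs_sheaf X) (@nonvanishing_sub U f) f))
        (res (lrs_sheaf X) (@nonvanishing_sub U f))].

End SpecMap.
End LRSpaceTheory.

Record scheme (k : fieldType) := Scheme {
  scheme_lrs :> lrspace k;
  scheme_affine : forall x : scheme_lrs, exists U : opens scheme_lrs,
    opens_set U x /\ is_affine U }.

Definition noetherian_ring (A : comPzRingType) :=
  forall I : set A, I 0 -> (forall a b, I a -> I b -> I (a + b)) ->
    (forall a b, I b -> I (a * b)) ->
  exists r (g : 'I_r -> A), (forall i, I (g i)) /\
    forall a, I a -> exists c : 'I_r -> A, a = \sum_i c i * g i.

Definition noetherian_scheme (k : fieldType) (B : scheme k) :=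
  exists r (U : 'I_r -> opens B),
    (forall i, is_affine (U i) /\ noetherian_ring (sec (lrs_sheaf B) (U i))) /\
    \bigcup_i U i = setT.

Definition rational_points (k : fieldType) (B : scheme k) : set B :=
  [set b | closed [set b] /\ forall c : kappa b, exists z, kappa_str b z = c].
Arguments rational_points {k} B.

Definition fin_gen (S : pzRingType) (N : lmodType S) :=
  exists r (g : 'I_r -> N), forall m, exists c : 'I_r -> S,
    m = \sum_i c i *: g i.

Definition is_basis (K : fieldType) (V : lmodType K) r (e : 'I_r -> V) :=
  forall v, exists! c : 'I_r -> K, v = \sum_i c i *: e i.

Definition dimension (R : realType) (K : fieldType) (V : lmodType K) : \bar R :=
  xget +oo%E [set d | exists r (e : 'I_r -> V), is_basis e /\ d = r%:R%:E].

Section Ext.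
Variable S : pzRingType.

Definition projective (P : lmodType S) :=
  forall (A B : lmodType S) (g : {linear A -> B}) (f : {linear P -> B}),
    (forall b, exists a, g a = b) ->
    exists h : {linear P -> A}, forall p, g (h p) = f p.

(* ... -> P_2 -> P_1 -> P_0 -> N -> 0, with d_i : P_{i+1} -> P_i *)
Record proj_resolution (N : lmodType S) := ProjResolution {
  pr_mod : nat -> lmodType S;
  pr_diff : forall i, {linear pr_mod i.+1 -> pr_mod i};
  pr_aug : {linear pr_mod 0%N -> N};
  pr_projective : forall i, projective (pr_mod i);
  pr_aug_surj : forall m, exists p, pr_aug p = m;
  pr_exact0 : forall p, pr_aug p = 0 <-> exists q, pr_diff 0%N q = p;
  pr_exact : forall i p, pr_diff i p = 0 <-> exists q, pr_diff i.+1 q = p }.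

Definition cocycle (N L : lmodType S) (P : proj_resolution N) j
    (f : {linear pr_mod P j -> L}) :=
  forall p, f (pr_diff P j p) = 0.

Definition coboundary (N L : lmodType S) (P : proj_resolution N) j :
    {linear pr_mod P j -> L} -> Prop :=
  match j with
  | 0 => fun f => forall p, f p = 0
  | i.+1 => fun f => exists g : {linear pr_mod P i -> L},
                       forall p, f p = g (pr_diff P i p)
  end.

(* Ext^j_S(N, L) = 0: since Ext does not depend on the resolution used to
   compute it, it suffices that H^j(Hom_S(P, L)) = 0 for one resolution P. *)
Definition Ext_vanishes (N L : lmodType S) j :=
  exists P : proj_resolution N,
    forall f : {linear pr_mod P j -> L}, cocycle f -> coboundary f.

End Ext.

Inductive weyl_gen (n : nat) (k : Type) :=
| WScal of k | WX of 'I_n | WD of 'I_n.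
Arguments WX {n k}.
Arguments WD {n k}.

Section Weyl.
Variables (n : nat) (k : fieldType).

Local Notation c_ c := (RGen (WScal n c)).
Local Notation X_ i := (RGen (WX i : weyl_gen n k)).
Local Notation D_ i := (RGen (WD i : weyl_gen n k)).

Inductive weyl_rel : rterm (weyl_gen n k) -> rterm (weyl_gen n k) -> Prop :=
| weyl_1 : weyl_rel (c_ 1) ROne
| weyl_add a b : weyl_rel (c_ (a + b)) (RAdd (c_ a) (c_ b))
| weyl_mul a b : weyl_rel (c_ (a * b)) (RMul (c_ a) (c_ b))
| weyl_cX a i : weyl_rel (RMul (c_ a) (X_ i)) (RMul (X_ i) (c_ a))
| weyl_cD a i : weyl_rel (RMul (c_ a) (D_ i)) (RMul (D_ i) (c_ a))
| weyl_XX i j : weyl_rel (RMul (X_ i) (X_ j)) (RMul (X_ j) (X_ i))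
| weyl_DD i j : weyl_rel (RMul (D_ i) (D_ j)) (RMul (D_ j) (D_ i))
| weyl_DX i j : weyl_rel (RMul (D_ i) (X_ j))
    (RAdd (RMul (X_ j) (D_ i)) (if i == j then ROne else RZero)).

Definition weyl : pzRingType := pres_ring weyl_rel.

Definition weyl_scal (c : k) : weyl := pres_gen weyl_rel (WScal n c).
Definition weyl_X (i : 'I_n) : weyl := pres_gen weyl_rel (WX i).
Definition weyl_D (i : 'I_n) : weyl := pres_gen weyl_rel (WD i).

Lemma weyl_scal_zmod : zmod_morphism weyl_scal.
Proof.
by apply: morphD_zmod => a b; rewrite -pres_clsD; apply/pres_rel; constructor.
Qed.
Lemma weyl_scal_monoid : monoid_morphism weyl_scal.
Proof.
by split=> [|a b]; [rewrite -pres_cls1|rewrite -pres_clsM];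
  apply/pres_rel; constructor.
Qed.
HB.instance Definition _ :=
  GRing.isZmodMorphism.Build k weyl weyl_scal weyl_scal_zmod.
HB.instance Definition _ :=
  GRing.isMonoidMorphism.Build k weyl weyl_scal weyl_scal_monoid.

Lemma weyl_scalX c i : GRing.comm (weyl_scal c) (weyl_X i).
Proof. by rewrite /GRing.comm -!pres_clsM; apply/pres_rel; constructor. Qed.
Lemma weyl_XC i j : GRing.comm (weyl_X i) (weyl_X j).
Proof. by rewrite /GRing.comm -!pres_clsM; apply/pres_rel; constructor. Qed.

End Weyl.

(* [mmap] asks that the x_i be central in S and that S be nontrivial. *)
Section PolyEval.
Variables (n : nat) (K : fieldType) (S : pzRingType).
Variables (h : {rmorphism K -> S}) (x : 'I_n -> S).
Hypothesis hx : forall c i, GRing.comm (h c) (x i).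
Hypothesis xx : forall i j, GRing.comm (x i) (x j).

Definition mono_eval (m : multinom n) : S := \prod_(i < n) x i ^+ m i.

Definition poly_eval of (forall c i, GRing.comm (h c) (x i)) &
    (forall i j, GRing.comm (x i) (x j)) : mpoly n K -> S :=
  fun p => \sum_(m <- msupp p) h (mcoeff m p) * mono_eval m.
Local Notation ev := (poly_eval hx xx).

Lemma mono_eval_comm y (m : multinom n) : (forall i, GRing.comm y (x i)) ->
  GRing.comm y (mono_eval m).
Proof.
by move=> yx; apply: commr_prod => i _; apply/commrX.
Qed.

Lemma mono_evalD m1 m2 :
  mono_eval (mnm_add m1 m2) = mono_eval m1 * mono_eval m2.
Proof.
rewrite /mono_eval.
under eq_bigr => i _ do rewrite mnmDE exprD.
by rewrite prodrM_comm // => i j _ _; apply/commrX/commr_sym/commrX.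
Qed.

Lemma poly_evalE p i : (mmeasure mdeg p <= i)%N ->
  ev p = \sum_(m : bmultinom n i) h (mcoeff m p) * mono_eval m.
Proof.
move=> le_pi; set I : subFinType _ := bmultinom n i.
rewrite /poly_eval (big_mksub I) ?msupp_uniq //=; first last.
  by move=> m /msize_mdeg_lt /leq_trans; apply.
rewrite big_rmcond //= => j /memN_msupp_eq0 ->.
by rewrite rmorph0 mul0r.
Qed.

Lemma poly_eval_zmod : zmod_morphism ev.
Proof.
move=> p q /=.
pose i := maxn (maxn (mmeasure mdeg p) (mmeasure mdeg q)) (mmeasure mdeg (p - q)).
rewrite !(@poly_evalE _ i) ?leq_max ?leqnn ?orbT // -sumrB; apply/eq_bigr.
by case=> /= [m _] _; rewrite !raddfB /= mulrDl mulNr.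
Qed.

HB.instance Definition _ :=
  GRing.isZmodMorphism.Build (mpoly n K) S ev poly_eval_zmod.

Lemma poly_evalZX c m : ev (c *: mpolyX K m) = h c * mono_eval m.
Proof.
have [->|c0] := eqVneq c 0; first by rewrite scale0r raddf0 rmorph0 mul0r.
rewrite /poly_eval (perm_big _ (msuppZ _ c0)) msuppX big_seq1.
by rewrite mcoeffZ mcoeffX eqxx mulr1.
Qed.

Lemma poly_evalC c : ev (mpolyC n c) = h c.
Proof.
have := poly_evalZX c mnm0; rewrite mpolyX0 -mul_mpolyC mulr1 => ->.
by rewrite /mono_eval big1 ?mulr1 // => i _; rewrite mnm0E.
Qed.

Lemma poly_eval_monoid : monoid_morphism ev.
Proof.
split=> [|p q].
  rewrite /poly_eval msupp1 big_seq1 mpolyCK rmorph1 mul1r /mono_eval.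
  by rewrite big1 // => i _; rewrite mnm0E.
pose i := maxn (mmeasure mdeg p) (mmeasure mdeg q).
have [ip iq] : (mmeasure mdeg p <= i /\ mmeasure mdeg q <= i)%N.
  by rewrite !leq_max !leqnn orbT.
rewrite (mpolywME ip iq) raddf_sum /= !(@poly_evalE _ i) //.
rewrite big_distrlr /= pair_bigA; apply/eq_bigr=> /=.
case=> j1 j2 _ /=; rewrite poly_evalZX mono_evalD rmorphM -!mulrA.
congr (_ * _); rewrite !mulrA; congr (_ * _).
by apply: mono_eval_comm => c; apply: hx.
Qed.
HB.instance Definition _ :=
  GRing.isMonoidMorphism.Build (mpoly n K) S ev poly_eval_monoid.

End PolyEval.

Section WeylTensor.
Variables (n : nat) (k : fieldType).
Local Notation D := (weyl n k).

Definition poly_D : {rmorphism mpoly n k -> D} :=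
  poly_eval (@weyl_scalX n k) (@weyl_XC n k).

Definition ratfun (K : fieldType) : fieldType := {fraction mpoly n K}.

Definition ratfun_const (K : fieldType) : {rmorphism K -> ratfun K} :=
  (@tofrac (mpoly n K) \o @mpolyC n K)%FUN.

Section Coeff.
Variables (A : comPzRingType) (iA : {rmorphism k -> A}).

Definition DA : pzRingType := tens (@weyl_scal n k) iA.
Definition polyA : pzRingType := tens (@mpolyC n k) iA.
Definition ratfunA : pzRingType := tens (ratfun_const k) iA.

Lemma poly_DC c : poly_D (mpolyC n c) = weyl_scal n c.
Proof.
exact: poly_evalC.
Qed.

Definition polyA_DA : {rmorphism polyA -> DA} :=
  tens_map poly_DC (fun c => erefl (idfun (iA c))).
Definition polyA_ratfunA : {rmorphism polyA -> ratfunA} :=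
  tens_map (fun c => erefl (ratfun_const k c)) (fun c => erefl (idfun (iA c))).

(* N(x) = k(x) (x)_{k[x]} N with its structure of module over k(x) (x)_k A: since
   k(x) (x)_k A = k(x) (x)_{k[x]} (k[x] (x)_k A), it is the extension of scalars
   of N along k[x] (x)_k A -> k(x) (x)_k A. *)
Definition generic (N : lmodType DA) : lmodType ratfunA :=
  extend polyA_ratfunA (restrict N polyA_DA).

End Coeff.

Definition DA_map (A A' : comPzRingType) (iA : {rmorphism k -> A})
    (iA' : {rmorphism k -> A'}) (g : {rmorphism A -> A'})
    (gP : forall c, g (iA c) = iA' c) : {rmorphism DA iA -> DA iA'} :=
  tens_map (fun c => erefl (idfun (weyl_scal n c))) gP.

Section Holonomic.
Variables (K : fieldType) (iK : {rmorphism k -> K}).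

(* D (x)_k K is the Weyl algebra over K *)
Definition is_holonomic (N : lmodType (DA iK)) :=
  fin_gen N /\ forall j, j <> n -> Ext_vanishes N ((DA iK)^o) j.

Lemma polyK_DA_scal (c : K) (i : 'I_n) :
  GRing.comm (tens_r (@weyl_scal n k) iK c) (tens_l (@weyl_scal n k) iK (weyl_X k i)).
Proof. exact/esym/tens_lr_comm. Qed.
Lemma polyK_DA_XX (i j : 'I_n) :
  GRing.comm (tens_l (@weyl_scal n k) iK (weyl_X k i))
             (tens_l (@weyl_scal n k) iK (weyl_X k j)).
Proof. by rewrite /GRing.comm -!rmorphM weyl_XC. Qed.

Definition polyK_DA : {rmorphism mpoly n K -> DA iK} :=
  poly_eval polyK_DA_scal polyK_DA_XX.

Definition holonomic_rank (R : realType) (N : lmodType (DA iK)) : \bar R :=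
  @dimension R (ratfun K) (extend (@tofrac (mpoly n K)) (restrict N polyK_DA)).

End Holonomic.
End WeylTensor.

Section Families.
Variables (n : nat) (k : fieldType) (B : scheme k).
Local Notation O := (sec (lrs_sheaf B)).

Definition DO (U : opens B) : pzRingType := DA n (struct_map U).

Definition DO_res (U V : opens B) (VU : V `<=` U) : {rmorphism DO U -> DO V} :=
  DA_map n (struct_map_res VU).

Definition DO_value (b : B) (U : opens B) (Ub : opens_set U b) :
    {rmorphism DO U -> DA n (kappa_str b)} :=
  DA_map n (value_struct Ub).

(* Sheaves of left (D (x)_k O_B)-modules *)
Record DO_module := DOModule {
  dm_sec : forall U : opens B, lmodType (DO U);
  dm_res : forall U V : opens B, V `<=` U -> {additive dm_sec U -> dm_sec V};
  dm_resZ : forall (U V : opens B) (VU : V `<=` U) (a : DO U) (m : dm_sec U),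
    dm_res VU (a *: m) = DO_res VU a *: dm_res VU m;
  dm_res_id : forall (U : opens B) (UU : U `<=` U) (m : dm_sec U),
    dm_res UU m = m;
  dm_res_comp : forall (U V W : opens B) (VU : V `<=` U) (WV : W `<=` V)
      (WU : W `<=` U) (m : dm_sec U),
    dm_res WV (dm_res VU m) = dm_res WU m;
  dm_glue : forall (U : opens B) (I : Type) (V : I -> opens B)
      (VU : forall i, V i `<=` U),
    U `<=` \bigcup_i V i ->
    forall m : forall i, dm_sec (V i),
    (forall i j, dm_res (@opensIl _ (V i) (V j)) (m i)
               = dm_res (@opensIr _ (V i) (V j)) (m j)) ->
    exists! t : dm_sec U, forall i, dm_res (VU i) t = m i }.

Variable M : DO_module.

Definition dm_mul (U : opens B) (f : O U) (m : dm_sec M U) : dm_sec M U :=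
  tens_r (@weyl_scal n k) (struct_map U) f *: m.

(* Every point has an affine open neighborhood U on which M is the sheaf
   associated to the O(U)-module M(U), whose sections over U_f are M(U)_f. *)
Definition is_quasicoherent := forall b : B, exists U : opens B,
  [/\ opens_set U b, is_affine U
    & forall f : O U, is_localization (dm_mul f)
        (dm_mul (res (lrs_sheaf B) (@nonvanishing_sub _ _ U f) f))
        (dm_res M (@nonvanishing_sub _ _ U f))].

Definition is_coherent_DO := is_quasicoherent /\
  forall U : opens B, is_affine U -> fin_gen (dm_sec M U).

(* The fiber of M at b, as a module over D (x)_k kappa_b: it is the colimit of
   (D (x) kappa_b) (x)_{D (x) O(U)} M(U) = kappa_b (x)_{O(U)} M(U) over the open
   neighborhoods U of b, i.e. kappa_b (x)_{O_b} M_b, where O_b and M_b are the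
   stalks at b. *)
Section Fiber.
Variable b : B.

Record mgerm := MGerm {
  mg_dom : opens B;
  mg_mem : opens_set mg_dom b;
  mg_sec : dm_sec M mg_dom }.

Inductive fiber_rel : mterm (DA n (kappa_str b)) mgerm ->
    mterm (DA n (kappa_str b)) mgerm -> Prop :=
| fiber_add (U : opens B) (Ub : opens_set U b) (m m' : dm_sec M U) :
    fiber_rel (MGen (MGerm Ub (m + m')))
      (MAdd (MGen (MGerm Ub m)) (MGen (MGerm Ub m')))
| fiber_scale (U : opens B) (Ub : opens_set U b) (a : DO U) (m : dm_sec M U) :
    fiber_rel (MGen (MGerm Ub (a *: m)))
      (MScale (DO_value Ub a) (MGen (MGerm Ub m)))
| fiber_res (U V : opens B) (VU : V `<=` U) (Ub : opens_set U b)
      (Vb : opens_set V b) (m : dm_sec M U) :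
    fiber_rel (MGen (MGerm Ub m)) (MGen (MGerm Vb (dm_res M VU m))).

Definition fiber : lmodType (DA n (kappa_str b)) := pres_mod fiber_rel.
End Fiber.

(* B(x) -> B is an affine morphism under which the inverse image of an affine open
   U is Spec (k(x) (x)_k O(U)); the sections of M(x) over it are k(x) (x)_{k[x]} M(U),
   so that M(x) is quasi-coherent on B(x) as soon as M is on B. *)
Definition rank_sheaf_coherent := forall U : opens B, is_affine U ->
  fin_gen (generic (dm_sec M U)).

Definition holonomic_family :=
  [/\ is_coherent_DO, forall b : B, is_holonomic (fiber b)
    & rank_sheaf_coherent].

Variable R : realType.

Definition rank (b : B) : \bar R := holonomic_rank R (fiber b).

Definition rank_jumping (b : B) := rational_points B b /\
  forall U : set B, open U -> U b ->
    (ereal_inf [set rank b' | b' in U `&` rational_points B] < rank b)%E.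

End Families.

Definition upper_semicontinuous (X : topologicalType) (R : realType)
    (f : X -> \bar R) :=
  forall x (a : R), (f x < a%:E)%E ->
    exists2 V, nbhs x V & forall y, V y -> (f y < a%:E)%E.

(* Main.v *)
Require Import Defs.
From HB Require Import structures.
From mathcomp Require Import -(notations) mpoly.
From mathcomp Require Import all_boot all_order all_algebra.
From mathcomp Require Import boolp classical_sets functions reals ereal.
From mathcomp Require Import topology complex.

(** Let U = Spec A be an affine chart on which M is quasi-coherent, and let
    N = C(x) (x)_{C[x]} M(U). By coherence of the rank sheaf, N has a finite
    family of generators v_1, ..., v_r over S = C(x) (x) A. For b in U with residue
    field K, evaluation of the coefficients is a ring morphism phi_b : S -> K(x),
    and the generic part K(x) (x)_{K[x]} M_b of the fiber is K(x) (x)_S N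
    ([generic_to_fiber], [fiber_to_generic]). By right exactness of extension of
    scalars, the relations between the v_i over K(x) are spanned by the images of
    their relations over S ([extend_relations]), so that

         rank M_b  =  r - (rank at b of the relations between the v_i in N)

    ([fiber_rank]). Relations of maximal rank at b_0 are finitely many, and their
    rank is witnessed by a minor, an element of S with nonzero image under phi_b0.
    Clearing denominators in C(x), that minor becomes a polynomial in x with
    coefficients in A, one of which does not vanish at b_0; wherever the latter does
    not vanish, the same relations have at least the same rank
    ([specialization_open]), and the rank of M is at most its value at b_0
    ([rank_le_near]).

    Most of the work is the identification of the fiber of the sheaf, which is
    presented by germs and carries an action of D, with the naive fiber K (x)_A M(U)
    ([fiber_to_mfiber], [chart_spanP]). A map out of the germs must be linear over
    D (x) K, hence K (x)_A M(U) has to be given its D-module structure first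
    ([mfiber_module]); the value of a germ is then read off after writing it near b
    as a fraction m / g with m in M(U) and g in A.

    The statement on rank jumps is formal: ranks are natural numbers, and a point
    that does not jump has minimal rank among the rational points of some
    neighborhood, so by semi-continuity the rank is constant on the rational points
    of a smaller one, none of which jumps. *)

Set Implicit Arguments.
Unset Strict Implicit.
Unset Printing Implicit Defensive.
Import Order.TTheory GRing.Theory Num.Theory.

Local Open Scope classical_set_scope.
Local Open Scope ring_scope.

(** * Universal properties of presented rings and modules *)

Section PresentationInduction.

Lemma pres_ring_ind (G : Type) (rel : rterm G -> rterm G -> Prop)
    (P : pres_ring rel -> Prop) :
    (forall g, P (pres_gen rel g)) -> P 0 -> P 1 ->
    (forall x, P x -> P (- x)) ->
    (forall x y, P x -> P y -> P (x + y)) ->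
    (forall x y, P x -> P y -> P (x * y)) ->
  forall x, P x.
Proof.
move=> Pg P0 P1 PN PD PM x; rewrite -(@zreprK (pres_setoid rel) x).
elim: (zrepr x) => [g||| t | t Pt u Pu | t Pt u Pu].
- exact: Pg.
- exact: P0.
- exact: P1.
- by move/PN; rewrite -[X in P X](@pres_clsN _ rel).
- by rewrite -[zcls _]/(pres_cls rel _) pres_clsD; apply: PD.
- by rewrite -[zcls _]/(pres_cls rel _) pres_clsM; apply: PM.
Qed.

Variables (S : pzRingType) (G : Type) (rel : mterm S G -> mterm S G -> Prop).
Let cls (t : mterm S G) : pres_mod rel := @mcls S (pres_mod_setoid rel) t.

Lemma pres_mod_ind (P : pres_mod rel -> Prop) :
    (forall g, P (pres_mod_gen rel g)) ->
    (forall x y, P x -> P y -> P (x + y)) ->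
    (forall a x, P x -> P (a *: x)) -> P 0 ->
  forall x, P x.
Proof.
move=> Pg PD PZ P0 x; rewrite -(@zreprK (pres_mod_setoid rel) x) -[zcls _]/(cls _).
elim: (zrepr x) => [g|| t Pt | t Pt u Pu | a t Pt].
- exact: Pg.
- exact: P0.
- have -> : cls (MOpp t) = - cls t by exact: (@zclsN (pres_mod_setoid rel)).
  by rewrite -scaleN1r; apply: PZ.
- have -> : cls (MAdd t u) = cls t + cls u by exact: (@zclsD (pres_mod_setoid rel)).
  exact: PD.
- have -> : cls (MScale a t) = a *: cls t by exact: (@mclsZ S (pres_mod_setoid rel)).
  exact: PZ.
Qed.

Lemma pres_mod_rel t u : rel t u -> cls t = cls u.
Proof. by move=> tu; apply/(@zclsP (pres_mod_setoid rel))/mc_rel. Qed.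

Variables (T : lmodType S) (f : G -> T).

Fixpoint meval (t : mterm S G) : T :=
  match t with
  | MGen g => f g | MZero => 0 | MOpp t => - meval t
  | MAdd t u => meval t + meval u | MScale a t => a *: meval t
  end.

Hypothesis fP : forall t u, rel t u -> meval t = meval u.

Lemma meval_cong t u : mcong rel t u -> meval t = meval u.
Proof.
elim=> /= *; do ?[exact: fP | congruence].
- by rewrite addrA.
- by rewrite addrC.
- by rewrite add0r.
- by rewrite addNr.
- by rewrite scalerA.
- by rewrite scale1r.
- by rewrite scalerDr.
- by rewrite scalerDl.
Qed.

Lemma pres_mod_lift :
  exists h : {linear pres_mod rel -> T}, forall g, h (pres_mod_gen rel g) = f g.
Proof.
pose h (x : pres_mod rel) := meval (@zrepr (pres_mod_setoid rel) x).
have hE t : h (cls t) = meval t by apply/meval_cong/(@zrepr_cls (pres_mod_setoid rel)).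
have hB : zmod_morphism h.
  apply: morphD_zmod => x y.
  rewrite -(@zreprK (pres_mod_setoid rel) x) -(@zreprK (pres_mod_setoid rel) y).
  by rewrite -!/(cls _) -[X in h X](@zclsD (pres_mod_setoid rel)) !hE.
have hZ : scalable h.
  move=> a x; rewrite -(@zreprK (pres_mod_setoid rel) x) -!/(cls _).
  by rewrite -[X in h X](@mclsZ S (pres_mod_setoid rel)) !hE.
pose hA := GRing.isZmodMorphism.Build _ _ h hB.
pose hS := GRing.isScalable.Build _ _ _ _ h hZ.
pose hL : {linear pres_mod rel -> T} := HB.pack h hA hS.
by exists hL => g; apply: hE.
Qed.

End PresentationInduction.

Lemma tens_ind (k : comPzRingType) (A B : pzRingType) (iA : {rmorphism k -> A})
    (iB : {rmorphism k -> B}) (P : tens iA iB -> Prop) :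
    (forall a, P (tens_l iA iB a)) -> (forall b, P (tens_r iA iB b)) ->
    (forall x y, P x -> P y -> P (x + y)) ->
    (forall x y, P x -> P y -> P (x * y)) ->
  forall x, P x.
Proof.
move=> Pl Pr PD PM.
have P0 : P 0 by rewrite -(rmorph0 (tens_l iA iB)); apply: Pl.
have P1 : P 1 by rewrite -(rmorph1 (tens_l iA iB)); apply: Pl.
have PN1 : P (- 1) by rewrite -(rmorphN1 (tens_l iA iB)); apply: Pl.
apply: pres_ring_ind => //; first by case=> a; [apply: Pl|apply: Pr].
by move=> x Px; rewrite -mulN1r; apply: PM.
Qed.

Section ExtensionUniversal.
Variables (P S : pzRingType) (f : {rmorphism P -> S}) (M : lmodType P).

Definition egen (m : M) : extend f M := pres_mod_gen _ m.

Lemma egenD : {morph egen : m m' / m + m'}.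
Proof.
move=> m m'; rewrite -[RHS](@zclsD (pres_mod_setoid (extend_rel f (M:=M)))).
by apply: pres_mod_rel; constructor.
Qed.
HB.instance Definition _ :=
  GRing.isZmodMorphism.Build M (extend f M) egen (morphD_zmod egenD).

Lemma egenZ a m : egen (a *: m) = f a *: egen m.
Proof.
rewrite -[RHS](@mclsZ S (pres_mod_setoid (extend_rel f (M:=M)))).
by apply: pres_mod_rel; constructor.
Qed.

Lemma extend_ind (Q : extend f M -> Prop) :
    (forall m, Q (egen m)) -> (forall x y, Q x -> Q y -> Q (x + y)) ->
    (forall a x, Q x -> Q (a *: x)) -> forall x, Q x.
Proof.
move=> Qg QD QZ; apply: pres_mod_ind => //.
by have := QZ 0 _ (Qg 0); rewrite scale0r.
Qed.

Lemma extend_lift (T : lmodType S) (g : M -> T) :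
    {morph g : m m' / m + m'} -> (forall a m, g (a *: m) = f a *: g m) ->
  exists h : {linear extend f M -> T}, forall m, h (egen m) = g m.
Proof. by move=> gD gZ; apply: pres_mod_lift => t u [] * /=; rewrite ?gD ?gZ. Qed.

End ExtensionUniversal.

(** * Modules over a tensor product of algebras *)

Section Endo.
Variable V : zmodType.

Record endo := Endo { endo_fun :> V -> V; endoB : zmod_morphism endo_fun }.

Lemma endoP (u v : endo) : (forall x, u x = v x) -> u = v.
Proof.
case: u v => [u uB] [v vB] /= /funext uv; rewrite uv in uB *.
by rewrite (Prop_irrelevance uB vB).
Qed.

HB.instance Definition _ (u : endo) := GRing.isZmodMorphism.Build V V u (endoB u).

HB.instance Definition _ := gen_eqMixin endo.
HB.instance Definition _ := gen_choiceMixin endo.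

Lemma endo0_subproof : zmod_morphism (fun _ : V => 0 : V).
Proof. by move=> x y; rewrite subr0. Qed.
Lemma endo1_subproof : zmod_morphism (@id V).
Proof. by []. Qed.
Lemma endoN_subproof (u : endo) : zmod_morphism (fun x => - u x).
Proof. by move=> x y; rewrite raddfB opprB opprK addrC. Qed.
Lemma endoD_subproof (u v : endo) : zmod_morphism (fun x => u x + v x).
Proof. by move=> x y; rewrite !raddfB opprD addrACA. Qed.
Lemma endoM_subproof (u v : endo) : zmod_morphism (fun x => u (v x)).
Proof. by move=> x y; rewrite !raddfB. Qed.

Let e0 := Endo endo0_subproof.
Let e1 := Endo endo1_subproof.
Let eN u := Endo (endoN_subproof u).
Let eD u v := Endo (endoD_subproof u v).
Let eM u v := Endo (endoM_subproof u v).

Let eDA : associative eD.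
Proof. by move=> u v w; apply: endoP => x /=; rewrite addrA. Qed.
Let eDC : commutative eD.
Proof. by move=> u v; apply: endoP => x /=; rewrite addrC. Qed.
Let eD0 : left_id e0 eD. Proof. by move=> u; apply: endoP => x /=; rewrite add0r. Qed.
Let eDN : left_inverse e0 eN eD.
Proof. by move=> u; apply: endoP => x /=; rewrite addNr. Qed.
HB.instance Definition _ := GRing.isZmodule.Build endo eDA eDC eD0 eDN.

Let eMA : associative eM. Proof. by move=> u v w; apply: endoP. Qed.
Let eM1l : left_id e1 eM. Proof. by move=> u; apply: endoP. Qed.
Let eM1r : right_id e1 eM. Proof. by move=> u; apply: endoP. Qed.
Let eMDl : left_distributive eM +%R. Proof. by move=> u v w; apply: endoP. Qed.
Let eMDr : right_distributive eM +%R.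
Proof. by move=> u v w; apply: endoP => x; apply: raddfD. Qed.
HB.instance Definition _ :=
  GRing.Zmodule_isPzRing.Build endo eMA eM1l eM1r eMDl eMDr.

Section EndoModule.
Variables (S : pzRingType) (rho : {rmorphism S -> endo}).

(** V with the S-module structure given by rho; the phantom argument keeps it apart
    from the structures that V already carries. *)
Definition endo_mod of {rmorphism S -> endo} : Type := V.
Local Notation W := (endo_mod rho).
HB.instance Definition _ := GRing.Zmodule.on W.

Let sc (a : S) (x : W) : W := rho a x.
Let scA a b x : sc a (sc b x) = sc (a * b) x.
Proof. by rewrite /sc rmorphM. Qed.
Let sc1 : left_id 1 sc. Proof. by move=> x; rewrite /sc rmorph1. Qed.
Let scDr : right_distributive sc +%R.
Proof. by move=> a x y; rewrite /sc [LHS]raddfD. Qed.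
Let scDl x : {morph sc^~ x : a b / a + b}.
Proof. by move=> a b; rewrite /sc rmorphD. Qed.
HB.instance Definition _ := GRing.Zmodule_isLmodule.Build S W scA sc1 scDr scDl.

Lemma endo_modZ a (x : W) : a *: x = rho a x. Proof. by []. Qed.
End EndoModule.
End Endo.

(** Commuting actions of A and B that agree on k are two ring morphisms into the
    additive endomorphisms of V, which the universal property of A (x)_k B merges
    into one. The module is returned as a copy W of V, since V is already a module
    over B. *)
Lemma tens_module (k : comPzRingType) (A B : pzRingType)
    (iA : {rmorphism k -> A}) (iB : {rmorphism k -> B}) (V : lmodType B)
    (act : A -> V -> V) :
    (forall a, {morph act a : x y / x + y}) ->
    (forall a b x, act a (b *: x) = b *: act a x) ->
    (forall a a' x, act (a + a') x = act a x + act a' x) ->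
    (forall a a' x, act (a * a') x = act a (act a' x)) ->
    (forall x, act 1 x = x) ->
    (forall c x, act (iA c) x = iB c *: x) ->
  exists (W : lmodType (tens iA iB)) (j : V -> W),
    [/\ {morph j : x y / x + y}, bijective j,
        forall a x, j (act a x) = tens_l iA iB a *: j x
      & forall b x, j (b *: x) = tens_r iA iB b *: j x].
Proof.
move=> aV aZ aD aM a1 ac.
pose l a := Endo (morphD_zmod (aV a)).
have sB (b : B) : zmod_morphism (fun x : V => b *: x).
  by move=> x y; rewrite scalerBr.
pose r b := Endo (sB b).
have lB : zmod_morphism l.
  by apply: morphD_zmod => a a'; apply: endoP => x; apply: aD.
have lM : monoid_morphism l.
  by split=> [|a a']; apply: endoP => x; [apply: a1|apply: aM].
have rB : zmod_morphism r.
  by apply: morphD_zmod => b b'; apply: endoP => x; apply: scalerDl.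
have rM : monoid_morphism r.
  by split=> [|b b']; apply: endoP => x; [apply: scale1r|rewrite /= scalerA].
pose l1 := GRing.isZmodMorphism.Build _ _ l lB.
pose l2 := GRing.isMonoidMorphism.Build _ _ l lM.
pose L : {rmorphism A -> endo V} := HB.pack l l1 l2.
pose r1 := GRing.isZmodMorphism.Build _ _ r rB.
pose r2 := GRing.isMonoidMorphism.Build _ _ r rM.
pose Rr : {rmorphism B -> endo V} := HB.pack r r1 r2.
have LR a b : L a * Rr b = Rr b * L a by apply: endoP => x; apply: aZ.
have Lc c : L (iA c) = Rr (iB c) by apply: endoP => x; apply: ac.
pose W := endo_mod (tens_lift LR Lc).
exists W, (fun x : V => x : W); split=> //; first by exists id.
- by move=> a x; rewrite endo_modZ tens_lift_l.
- by move=> b x; rewrite endo_modZ tens_lift_r.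
Qed.

(** * Relations, bases and minors *)

Section Relations.
Variables (S : pzRingType) (r : nat).

Definition lincomb (N : lmodType S) (v : 'I_r -> N) (c : 'rV[S]_r) : N :=
  \sum_i c 0 i *: v i.

Lemma lincombD (N : lmodType S) (v : 'I_r -> N) : {morph lincomb v : c d / c + d}.
Proof.
move=> c d; rewrite /lincomb -big_split; apply: eq_bigr => i _ /=.
by rewrite mxE scalerDl.
Qed.

Lemma lincombZ (N : lmodType S) (v : 'I_r -> N) a c :
  lincomb v (a *: c) = a *: lincomb v c.
Proof.
by rewrite /lincomb scaler_sumr; apply: eq_bigr => i _; rewrite mxE scalerA.
Qed.

HB.instance Definition _ (N : lmodType S) (v : 'I_r -> N) :=
  GRing.isZmodMorphism.Build _ _ (lincomb v) (morphD_zmod (lincombD v)).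

Definition generates (N : lmodType S) (v : 'I_r -> N) :=
  forall x, exists c, x = lincomb v c.

(** The rank is at most r, so some finite family of vectors satisfying P has
    maximal rank in L^r, and adjoining one more vector cannot enlarge its span. *)
Lemma finite_span (L : fieldType) (phi : {rmorphism S -> L})
    (P : 'rV[S]_r -> Prop) :
  exists t (T : 'M[S]_(t, r)), (forall i, P (row i T)) /\
    forall u, P u -> (map_mx phi u <= map_mx phi T)%MS.
Proof.
pose Q d := `[< exists t (T : 'M[S]_(t, r)),
  (forall i, P (row i T)) /\ \rank (map_mx phi T) = d >].
have Q0 : exists d, Q d.
  exists (\rank (map_mx phi (0 : 'M[S]_(0, r)))); apply/asboolP.
  by exists 0, 0; split=> // -[].
have Qr d : Q d -> (d <= r)%N.
  by case/asboolP=> t [T [_ <-]]; apply: rank_leq_col.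
case: (ex_maxnP Q0 Qr) => d /asboolP[t [T [PT rT]]] max_d.
exists t, T; split=> // u Pu.
have /max_d : Q (\rank (map_mx phi (col_mx T u))).
  apply/asboolP; exists _, (col_mx T u); split=> // i.
  case: (split_ordP i) => j ->.
    by rewrite rowKu.
  by rewrite rowKd (_ : row j u = u) //; apply/rowP => a; rewrite mxE ord1.
have TTu : (map_mx phi T <= map_mx phi (col_mx T u))%MS.
  by rewrite map_col_mx -addsmxE addsmxSl.
rewrite -rT (geq_leqif (mxrank_leqif_sup TTu)) map_col_mx -addsmxE => uT.
exact: submx_trans (addsmxSr _ _) uT.
Qed.

End Relations.

Section Dimension.
Variables (R : realType) (L : fieldType) (V : lmodType L).

(** The matrix that expresses e in terms of f has independent rows. *)
Lemma basis_leq a b (e : 'I_a -> V) (f : 'I_b -> V) :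
  is_basis e -> is_basis f -> (a <= b)%N.
Proof.
move=> he hf.
have /choice[T TE] i : exists c : 'I_b -> L, e i = \sum_j c j *: f j.
  by have [c [cE _]] := hf (e i); exists c.
pose A := \matrix_(i, j) T i j.
suff /eqP <- : row_free A by apply: rank_leq_col.
apply/inj_row_free => v vA.
have ve : \sum_i v 0 i *: e i = 0.
  under eq_bigr => i _ do rewrite TE scaler_sumr.
  rewrite exchange_big /= big1 // => j _.
  under eq_bigr => i _ do rewrite scalerA.
  rewrite -scaler_suml; have /rowP/(_ j) := vA.
  rewrite !mxE => vAj; rewrite [X in X *: _](_ : _ = 0) ?scale0r //.
  by rewrite -[RHS]vAj; apply: eq_bigr => i _; rewrite mxE.
have [c [_ cU]] := he 0.
have cv : c = (fun i => v 0 i) by apply: cU; rewrite ve.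
have c0 : c = (fun=> 0) by apply: cU; rewrite big1 // => i _; rewrite scale0r.
by apply/rowP => i; rewrite mxE -[LHS]/((fun i => v 0 i) i) -cv c0.
Qed.

Lemma dimension_basis a (e : 'I_a -> V) :
  is_basis e -> dimension R V = (a%:R)%:E.
Proof.
move=> he; rewrite /dimension.
have := @xgetPex _ (+oo%E : \bar R)
  [set d | exists r (e : 'I_r -> V), is_basis e /\ d = r%:R%:E].
case; first by exists (a%:R)%:E, a, e.
move=> b [f [hf ->]]; congr ((_%:R)%:E); apply/eqP.
by rewrite eqn_leq (basis_leq he hf) (basis_leq hf he).
Qed.

(** The combinations of the v_i whose coefficients run over a basis of a complement
    of the row space of C form a basis of V. *)
Lemma dimension_relations r t (v : 'I_r -> V) (C : 'M[L]_(t, r)) :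
    generates v -> (forall u, lincomb v u = 0 <-> (u <= C)%MS) ->
  dimension R V = ((r - \rank C)%N%:R)%:E.
Proof.
move=> genv relC.
pose D := row_base (C^C)%MS.
pose e j := lincomb v (row j D).
have eE (c : 'rV_(\rank (C^C)%MS)) : \sum_i c 0 i *: e i = lincomb v (c *m D).
  rewrite mulmx_sum_row raddf_sum; apply: eq_bigr => i _.
  by rewrite /= lincombZ.
rewrite -mxrank_compl; apply: (dimension_basis (e := e)) => w.
have [u ->] := genv w.
have : (u <= C + D)%MS.
  rewrite submx_full // /row_full (adds_eqmx (eqmx_refl C) (eq_row_base _)).
  by have := addsmx_compl_full C; rewrite /row_full.
case/sub_addsmxP => -[u1 c] /= uE.
have lu : lincomb v u = lincomb v (c *m D).
  rewrite uE raddfD /=; suff -> : lincomb v (u1 *m C) = 0 by rewrite add0r.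
  by apply/relC/submxMl.
exists (fun i => c 0 i); split=> [|d dE]; first by rewrite lu -eE.
pose d' := \row_i d i.
have dE' : lincomb v (d' *m D) = lincomb v u.
  by rewrite dE -eE; apply: eq_bigr => i _; rewrite mxE.
have : lincomb v ((c - d') *m D) = 0.
  by rewrite mulmxBl raddfB /= dE' lu subrr.
move/relC => cdC.
have cdD : ((c - d') *m D <= C^C)%MS.
  by apply: submx_trans (submxMl _ _) _; rewrite eq_row_base.
have /eqP : (c - d') *m D = 0.
  by apply/eqP; rewrite -submx0 -(capmx_compl C) sub_capmx cdC cdD.
rewrite mulmx_free_eq0 ?row_base_free // subr_eq0 => /eqP cd.
by apply/funext => i; rewrite cd mxE.
Qed.

End Dimension.

Lemma rank_minor (L : fieldType) t r (A : 'M[L]_(t, r)) :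
  exists (f : 'I_(\rank A) -> 'I_t) (g : 'I_(\rank A) -> 'I_r),
    \det (mxsub f g A) != 0.
Proof.
have [f fA] : exists f : 'I_(\rank A) -> 'I_t, row_free (rowsub f A).
  by eexists; apply: maxrowsub_free.
have fT : row_full (rowsub f A)^T by rewrite /row_full mxrank_tr.
exists f, (fullrankfun fT); have := fullrowsub_unit fT.
rewrite unitmxE unitfE -det_tr; congr (\det _ != 0).
by apply/matrixP => i j; rewrite !mxE.
Qed.

Lemma minor_rank (L : fieldType) t r d (f : 'I_d -> 'I_t) (g : 'I_d -> 'I_r)
    (A : 'M[L]_(t, r)) : \det (mxsub f g A) != 0 -> (d <= \rank A)%N.
Proof.
rewrite -unitfE -unitmxE => /mxrank_unit {1}<-.
have -> : mxsub f g A = (rowsub g (rowsub f A)^T)^T.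
  by apply/matrixP => i j; rewrite !mxE.
rewrite mxrank_tr (leq_trans (mxrankS (rowsub_sub _ _))) // mxrank_tr.
exact/mxrankS/rowsub_sub.
Qed.

(** Right exactness of extension of scalars: mapping the generator v_i to the i-th
    unit vector modulo the relations of N defines an S-semilinear map on N, whose
    extension to L (x)_S N detects the relations between the 1 (x) v_i. The
    quotient of L^r by the row space of A is realized as the image of cokermx A. *)
Lemma extend_relations (S : pzRingType) (L : fieldType)
    (phi : {rmorphism S -> L}) (N : lmodType S) r (v : 'I_r -> N) :
    generates v ->
  exists t (T : 'M[S]_(t, r)), [/\ forall i, lincomb v (row i T) = 0,
      forall u, lincomb v u = 0 -> (map_mx phi u <= map_mx phi T)%MS
    & forall c, lincomb (fun i => egen phi (v i)) c = 0 ->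
        (c <= map_mx phi T)%MS].
Proof.
move=> genv.
have [t [T [relT maxT]]] := finite_span phi (fun u => lincomb v u = 0).
exists t, T; split=> // c; set A := map_mx phi T in maxT *.
have /choice[s sE] := genv.
have gE u x : x = lincomb v u ->
    map_mx phi (s x) *m cokermx A = map_mx phi u *m cokermx A.
  move=> xE; apply/eqP; rewrite -subr_eq0 -mulmxBl -map_mxB -submxE.
  by apply: maxT; rewrite raddfB /= -xE -sE subrr.
have [||h hE] := @extend_lift _ _ phi N 'rV[L]_r
  (fun x => map_mx phi (s x) *m cokermx A).
- move=> x y; rewrite (gE (s x + s y)) ?map_mxD ?mulmxDl //.
  by rewrite raddfD /= -!sE.
- move=> a x; rewrite (gE (a *: s x)) ?lincombZ -?sE //.
  by rewrite map_mxZ scalemxAl.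
move/(congr1 h); rewrite raddf0 raddf_sum => hc; rewrite submxE -[X in _ == X]hc.
apply/eqP; rewrite {1}(row_sum_delta c) mulmx_suml; apply: eq_bigr => i _.
rewrite /= linearZ hE (gE (delta_mx 0 i)); last first.
  rewrite /lincomb (bigD1 i) //= mxE !eqxx scale1r big1 ?addr0 // => j ji.
  by rewrite mxE (negPf ji) andbF scale0r.
by rewrite map_delta_mx -scalemxAl.
Qed.

(** * Fractions and polynomials *)

Section FractionLift.
Variable A : idomainType.

Lemma fractionP (x : {fraction A}) :
  exists a b, b != 0 /\ x * FracField.tofrac b = FracField.tofrac a.
Proof.
elim/quotW: x => x; exists x.1, x.2; split; first exact: denom_ratioP.
rewrite /FracField.tofrac; unlock.
rewrite -[LHS]FracField.pi_mul /FracField.mulf.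
apply/eqmodP; rewrite /= FracField.equivfE.
by rewrite !numden_Ratio ?mulf_neq0 ?oner_neq0 ?denom_ratioP // !mulr1 mulrC.
Qed.

(** An injective ring morphism into a field extends to the field of fractions; the
    value at a / b is characterized without choosing a representative. *)
Lemma fraction_lift (F : fieldType) (g : {rmorphism A -> F}) :
    (forall a, g a = 0 -> a = 0) ->
  exists h : {rmorphism {fraction A} -> F}, forall a, h (FracField.tofrac a) = g a.
Proof.
move=> g0.
have gn0 a : a != 0 -> g a != 0 by apply: contra_neq => /g0.
have /choice[h hP] (x : {fraction A}) : exists y, forall a b,
    x * FracField.tofrac b = FracField.tofrac a -> y * g b = g a.
  have [a [b [b0 xE]]] := fractionP x; exists (g a / g b) => c d xE'.
  apply/eqP; rewrite mulrAC -(inj_eq (mulIf (gn0 _ b0))) divfK ?gn0 //.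
  rewrite -!rmorphM; apply/eqP; congr (g _).
  apply/eqP; rewrite -tofrac_eq !rmorphM /= -xE -xE'.
  by rewrite mulrAC.
have hD : {morph h : x y / x + y}.
  move=> x y; have [a [b [b0 xE]]] := fractionP x.
  have [c [d [d0 yE]]] := fractionP y.
  apply: (mulIf (gn0 _ (mulf_neq0 b0 d0))).
  rewrite (hP _ (a * d + c * b)); last first.
    rewrite !rmorphD !rmorphM /= -xE -yE mulrDl mulrA.
    by rewrite (mulrC (FracField.tofrac b)) mulrA.
  rewrite !rmorphD !rmorphM /= -(hP _ _ _ xE) -(hP _ _ _ yE).
  by rewrite mulrDl mulrA [in RHS](mulrC (g b)) mulrA.
have hM : {morph h : x y / x * y}.
  move=> x y; have [a [b [b0 xE]]] := fractionP x.
  have [c [d [d0 yE]]] := fractionP y.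
  apply: (mulIf (gn0 _ (mulf_neq0 b0 d0))).
  rewrite (hP _ (a * c)); last by rewrite !rmorphM /= -xE -yE mulrACA.
  by rewrite !rmorphM /= -(hP _ _ _ xE) -(hP _ _ _ yE) mulrACA.
have hE a : h (FracField.tofrac a) = g a.
  by rewrite -[LHS]mulr1 -(rmorph1 g); apply: hP; rewrite rmorph1 mulr1.
have h1 : h 1 = 1 by rewrite -(rmorph1 (@FracField.tofrac A)) hE rmorph1.
pose hA := GRing.isZmodMorphism.Build _ _ h (morphD_zmod hD).
pose hMM := GRing.isMonoidMorphism.Build _ _ h (conj h1 hM).
by exists (HB.pack h hA hMM : {rmorphism _ -> _}).
Qed.

End FractionLift.

Section Polynomials.
Variables (n : nat) (K : fieldType).

Lemma mpoly_subring_ind (P : mpoly n K -> Prop) :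
    (forall c, P (mpolyC n c)) -> (forall i, P (mpolyX K (mnm1 i))) ->
    (forall p q, P p -> P q -> P (p + q)) ->
    (forall p q, P p -> P q -> P (p * q)) ->
  forall p, P p.
Proof.
move=> PC PX PD PM.
have P0 : P 0 by have := PC 0; rewrite rmorph0.
have P1 : P 1 by have := PC 1; rewrite rmorph1.
elim/mpolyind => [//|c m p _ _ Pp]; apply/PD/Pp.
rewrite -mul_mpolyC; apply/PM => //.
rewrite mpolyXE_id; apply: (big_ind P P1) => [|i _]; first exact: PM.
by elim: (m i) => [|d Pd]; rewrite ?expr0 // exprS; apply: PM.
Qed.

Lemma poly_evalX (S : pzRingType) (h : {rmorphism K -> S}) (x : 'I_n -> S)
    (hx : forall c i, GRing.comm (h c) (x i))
    (xx : forall i j, GRing.comm (x i) (x j)) i :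
  poly_eval hx xx (mpolyX K (mnm1 i)) = x i.
Proof.
rewrite -[mpolyX _ _]scale1r poly_evalZX rmorph1 mul1r /mono_eval.
under eq_bigr => j _ do rewrite mnm1E.
have xxX j l : GRing.comm (x j ^+ (i == j)) (x l ^+ (i == l)).
  by apply/commrX/commr_sym/commrX.
rewrite (eq_bigr (fun j => if i == j then x i else 1)); last first.
  by move=> j _; case: eqVneq => [->|_]; rewrite ?expr1 ?expr0.
rewrite -big_mkcond /= (eq_bigl (pred1 i)) ?big_pred1_eq //.
Qed.

End Polynomials.

(** * The naive fiber of a D-module over A *)

Section ModuleFiber.
Variables (n : nat) (k : fieldType) (A : comPzRingType) (iA : {rmorphism k -> A}).
Variables (K : fieldType) (iK : {rmorphism k -> K}) (val : {rmorphism A -> K}).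
Hypothesis valE : forall c, val (iA c) = iK c.
Variable N : lmodType (DA n iA).

Local Notation LA := (tens_l (@weyl_scal n k) iA).
Local Notation RA := (tens_r (@weyl_scal n k) iA).
Local Notation LK := (tens_l (@weyl_scal n k) iK).
Local Notation RK := (tens_r (@weyl_scal n k) iK).

(** K (x)_A N, as a vector space over K. *)
Definition mfiber : lmodType K := extend val (Defs.restrict N RA).

Definition mgen (m : N) : mfiber := egen val (m : Defs.restrict N RA).

Lemma mgenD : {morph mgen : m m' / m + m'}.
Proof. by move=> m m'; apply: egenD. Qed.

Lemma mgenZ a m : mgen (RA a *: m) = val a *: mgen m.
Proof. exact: egenZ. Qed.

Lemma mgen0 : mgen 0 = 0.
Proof. by apply: (addIr (mgen 0)); rewrite -mgenD !add0r. Qed.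

(** The span is over K only, although F is a module over D (x) K. *)
Inductive scal_span (F : lmodType (DA n iK)) (u : N -> F) : F -> Prop :=
| scal_span_gen m : scal_span u (u m)
| scal_spanD x y of scal_span u x & scal_span u y : scal_span u (x + y)
| scal_spanZ c x of scal_span u x : scal_span u (RK c *: x).

Lemma mfiber_ind (P : mfiber -> Prop) :
    (forall m, P (mgen m)) -> (forall x y, P x -> P y -> P (x + y)) ->
    (forall a x, P x -> P (a *: x)) -> forall x, P x.
Proof. exact: (@extend_ind _ _ val (Defs.restrict N RA) P). Qed.

(** The Weyl algebra acts on N by A-linear maps, hence by functoriality on
    K (x)_A N, and this action commutes with K. *)
Lemma mfiber_module :
  exists (W : lmodType (DA n iK)) (j : mfiber -> W),
    [/\ {morph j : x y / x + y}, bijective j,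
        forall w m, j (mgen (LA w *: m)) = LK w *: j (mgen m)
      & forall c x, j (c *: x) = RK c *: j x].
Proof.
have /choice[act actE] (w : weyl n k) :
    exists a : {linear mfiber -> mfiber},
      forall m, a (mgen m) = mgen (LA w *: m).
  apply: extend_lift => [m m'|a m].
    by rewrite -mgenD; congr mgen; apply: scalerDr.
  rewrite -mgenZ; congr mgen; rewrite [RHS]scalerA -[in RHS]tens_lr_comm.
  by rewrite -[RHS]scalerA.
have [|||||| W [j [jD jb jw jr]]] := @tens_module _ _ _ (@weyl_scal n k)
  iK mfiber (fun w => act w : mfiber -> mfiber).
- by move=> a x y; rewrite linearD.
- by move=> a c x; rewrite linearZ.
- move=> a a'; apply: mfiber_ind => [m|x y ax ay|c x ax].
  + by rewrite !actE rmorphD scalerDl mgenD.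
  + by rewrite !linearD ax ay addrACA.
  + by rewrite !linearZ ax -scalerDr.
- move=> a a'; apply: mfiber_ind => [m|x y ax ay|c x ax].
  + by rewrite !actE rmorphM scalerA.
  + by rewrite !linearD ax ay.
  + by rewrite !linearZ ax.
- apply: mfiber_ind => [m|x y ax ay|c x ax].
  + by rewrite !actE rmorph1 scale1r.
  + by rewrite linearD ax ay.
  + by rewrite linearZ ax.
- move=> c; apply: mfiber_ind => [m|x y ax ay|d x ax].
  + by rewrite actE tens_baseE mgenZ valE.
  + by rewrite linearD ax ay scalerDr.
  + by rewrite linearZ /= ax !scalerA mulrC.
by exists W, j; split=> // w m; rewrite -actE jw.
Qed.

End ModuleFiber.

(** * Fractions on an affine chart, and the fiber at a point *)

Lemma iter_mulr (A : comPzRingType) (f s : A) d : iter d ( *%R f) s = f ^+ d * s.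
Proof. by elim: d => [|d IHd] /=; rewrite ?expr0 ?mul1r // exprS -mulrA IHd. Qed.

Section ModuleSheaf.
Variables (n : nat) (k : fieldType) (B : scheme k) (M : DO_module n B).

Local Notation O := (sec (lrs_sheaf B)).
Local Notation ores := (res (lrs_sheaf B)).

Lemma dm_mul_tens (V : opens B) (f : O V) (m : dm_sec M V) :
  dm_mul f m = tens_r (@weyl_scal n k) (struct_map V) f *: m.
Proof. by []. Qed.

Lemma dm_mulM (V : opens B) (f g : O V) (m : dm_sec M V) :
  dm_mul (f * g) m = dm_mul f (dm_mul g m).
Proof. by rewrite !dm_mul_tens rmorphM scalerA. Qed.

Lemma dm_mulDr (V : opens B) (f : O V) (m m' : dm_sec M V) :
  dm_mul f (m + m') = dm_mul f m + dm_mul f m'.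
Proof. by rewrite !dm_mul_tens scalerDr. Qed.

Lemma dm_mul1 (V : opens B) (m : dm_sec M V) : dm_mul (1 : O V) m = m.
Proof. by rewrite dm_mul_tens rmorph1 scale1r. Qed.

Lemma dm_mulC (V : opens B) (f g : O V) (m : dm_sec M V) :
  dm_mul f (dm_mul g m) = dm_mul g (dm_mul f m).
Proof. by rewrite -!dm_mulM mulrC. Qed.

Lemma dm_mul_weyl (V : opens B) (f : O V) w (m : dm_sec M V) :
  dm_mul f (tens_l _ _ w *: m) = tens_l (@weyl_scal n k) (struct_map V) w *: dm_mul f m.
Proof. by rewrite !dm_mul_tens !scalerA tens_lr_comm. Qed.

Lemma dm_res_mul (V W : opens B) (WV : W `<=` V) (f : O V) (m : dm_sec M V) :
  dm_res M WV (dm_mul f m) = dm_mul (ores WV f) (dm_res M WV m).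
Proof. by rewrite dm_mul_tens dm_resZ tens_lift_r. Qed.

Lemma dm_res_weyl (V W : opens B) (WV : W `<=` V) w (m : dm_sec M V) :
  dm_res M WV (tens_l _ _ w *: m) = tens_l _ _ w *: dm_res M WV m.
Proof. by rewrite dm_resZ tens_lift_l. Qed.

Lemma iter_dm_mul (V : opens B) (f : O V) (m : dm_sec M V) d :
  iter d (dm_mul f) m = dm_mul (f ^+ d) m.
Proof. by elim: d => [|d IHd] /=; rewrite ?expr0 ?dm_mul1 // exprS dm_mulM IHd. Qed.

End ModuleSheaf.

Section AffineCharts.
Variables (n : nat) (k : fieldType) (B : scheme k) (M : DO_module n B).
Variable U : opens B.

Local Notation O := (sec (lrs_sheaf B)).
Local Notation ores := (res (lrs_sheaf B)).

Definition quasicoherent_on :=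
  forall f : O U, is_localization (dm_mul (M := M) f)
    (dm_mul (ores (@nonvanishing_sub _ _ U f) f))
    (dm_res M (@nonvanishing_sub _ _ U f)).

Hypothesis affU : is_affine U.
Hypothesis qcU : quasicoherent_on.

Lemma value_irr (b : B) (V : opens B) (Vb Vb' : opens_set V b) (f : O V) :
  value Vb f = value Vb' f.
Proof. by rewrite (Prop_irrelevance Vb Vb'). Qed.

(** The map U -> Spec A is open and injective, and basic open sets form a basis of
    the topology of Spec A. *)
Lemma affine_basis (b : B) (Ub : opens_set U b) (W : opens B) : opens_set W b ->
  exists f : O U, [/\ value Ub f != 0, opens_set (nonvanishing f) b
    & nonvanishing f `<=` W].
Proof.
move=> Wb; have [[inv invl invr] _ oU _] := affU.
have oW : open (@set_val _ (opens_set U) @^-1` W).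
  by apply: open_comp (opens_open W) => x _; apply: initial_continuous.
have [E WE] := oU _ oW.
pose bU : opens_set U := exist _ b (mem_set Ub).
have : (@to_spec _ _ U @` (@set_val _ (opens_set U) @^-1` W)) (to_spec bU).
  by exists bU.
rewrite WE => -[f Ef /= fb].
have fb0 : value Ub f != 0.
  by apply/eqP => fb0; apply: fb; exact: etrans (value_irr _ Ub f) fb0.
exists f; split=> //; first by exists Ub.
move=> y [Uy fy]; pose yU : opens_set U := exist _ y (mem_set Uy).
have : (@to_spec _ _ U @` (@set_val _ (opens_set U) @^-1` W)) (to_spec yU).
  rewrite WE; exists f => // f0; move/eqP: fy; apply.
  by rewrite -[RHS]f0; congr (value _ f); apply: Prop_irrelevance.
case=> z Wz /(can_inj invl) zy; move: Wz; rewrite zy; exact.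
Qed.

(* The residue field at b enters only through the evaluations of functions at b and
   [affine_basis], so K, ev and basisU are kept abstract. *)
Section AtPoint.
Variables (b : B) (Ub : opens_set U b).
Variables (K : fieldType) (iK : {rmorphism k -> K}).
Variable ev : forall V : opens B, opens_set V b -> {rmorphism O V -> K}.
Hypothesis evE : forall V (Vb : opens_set V b) c, ev Vb (struct_map V c) = iK c.
Hypothesis ev_res : forall (V W : opens B) (WV : W `<=` V) (Vb : opens_set V b)
  (Wb : opens_set W b) s, ev Wb (ores WV s) = ev Vb s.
Hypothesis basisU : forall W : opens B, opens_set W b ->
  exists f : O U, [/\ ev Ub f != 0, opens_set (nonvanishing f) b
    & nonvanishing f `<=` W].

Local Notation val := (ev Ub).
Local Notation LK := (tens_l (@weyl_scal n k) iK).
Local Notation RK := (tens_r (@weyl_scal n k) iK).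

(** A section over U that vanishes near b is killed by a power of some f with
    f(b) != 0, because M(D(f)) is the localization of M(U). *)
Lemma section_zero_near (W : opens B) (WU : W `<=` U) (z : dm_sec M U) :
    opens_set W b -> dm_res M WU z = 0 ->
  exists g : O U, val g != 0 /\ dm_mul g z = 0.
Proof.
move=> Wb z0; have [f [fb _ fW]] := basisU Wb.
have [_ _ ker] := qcU f.
have /ker[d dz] : dm_res M (@nonvanishing_sub _ _ U f) z = 0.
  by rewrite -(dm_res_comp WU fW) z0 raddf0.
exists (f ^+ d); rewrite rmorphXn expf_neq0 //; split=> //.
by rewrite -iter_dm_mul.
Qed.

Lemma section_fraction (V : opens B) (m : dm_sec M V) : opens_set V b ->
  exists (W : opens B) (WU : W `<=` U) (WV : W `<=` V) (g : O U) (m' : dm_sec M U),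
    [/\ opens_set W b, val g != 0
      & dm_res M WU m' = dm_mul (ores WU g) (dm_res M WV m)].
Proof.
move=> Vb; have [f [fb Wb fV]] := basisU Vb.
have [_ frac _] := qcU f; have [d [m' mE]] := frac (dm_res M fV m).
exists (nonvanishing f), (@nonvanishing_sub _ _ U f), fV, (f ^+ d), m'; split=> //.
  by rewrite rmorphXn expf_neq0.
by rewrite -mE iter_dm_mul rmorphXn.
Qed.

Lemma function_fraction (V : opens B) (s : O V) : opens_set V b ->
  exists (W : opens B) (WU : W `<=` U) (WV : W `<=` V) (g s' : O U),
    [/\ opens_set W b, val g != 0 & ores WU s' = ores WU g * ores WV s].
Proof.
move=> Vb; have [f [fb Wb fV]] := basisU Vb.
have [_ _ _ loc] := affU.
have [_ frac _] := loc f; have [d [s' sE]] := frac (ores fV s).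
exists (nonvanishing f), (@nonvanishing_sub _ _ U f), fV, (f ^+ d), s'; split=> //.
  by rewrite rmorphXn expf_neq0.
by rewrite -sE iter_mulr rmorphXn.
Qed.

Local Notation cfiber := (mfiber val (dm_sec M U)).
Local Notation cgen := (mgen val (N := dm_sec M U)).

Let cgen_mul f m : cgen (dm_mul f m) = val f *: cgen m.
Proof. exact: (mgenZ val). Qed.

(** The value at b of a germ s, which is m' / g near b, is g(b)^-1 (x) m'. It is
    defined as a relation, so that any such fraction can be used to compute it. *)
Definition germ_value (s : mgerm M b) (q : cfiber) :=
  exists (W : opens B) (WU : W `<=` U) (WV : W `<=` mg_dom s) (g : O U)
    (m' : dm_sec M U),
    [/\ opens_set W b, val g != 0,
        dm_res M WU m' = dm_mul (ores WU g) (dm_res M WV (mg_sec s))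
      & val g *: q = cgen m'].

Lemma germ_value_ex s : exists q, germ_value s q.
Proof.
have [W [WU [WV [g [m' [Wb g0 mE]]]]]] := section_fraction (mg_sec s) (mg_mem s).
exists ((val g)^-1 *: cgen m'), W, WU, WV, g, m'.
by rewrite scalerA divff // scale1r.
Qed.

Lemma fraction_res (V W I : opens B) (WU : W `<=` U) (WV : W `<=` V)
    (g : O U) (m' : dm_sec M U) (m : dm_sec M V)
    (IU : I `<=` U) (IV : I `<=` V) : I `<=` W ->
    dm_res M WU m' = dm_mul (ores WU g) (dm_res M WV m) ->
  dm_res M IU m' = dm_mul (ores IU g) (dm_res M IV m).
Proof.
move=> IW mE.
rewrite -(dm_res_comp WU IW IU) mE dm_res_mul (dm_res_comp WV IW IV).
by rewrite (res_comp WU IW IU).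
Qed.

Lemma cgen_eq (W : opens B) (WU : W `<=` U) (m m' : dm_sec M U) :
  opens_set W b -> dm_res M WU m = dm_res M WU m' -> cgen m = cgen m'.
Proof.
move=> Wb mm'; have zW : dm_res M WU (m - m') = 0 by rewrite raddfB /= mm' subrr.
have [g [g0 gz]] := section_zero_near Wb zW.
have := cgen_mul g (m - m'); rewrite gz (mgen0 val) => /esym/eqP.
rewrite scaler_eq0 (negPf g0) /= => /eqP zm.
by rewrite -[m](subrK m') mgenD zm add0r.
Qed.

(** Two fractions m / g and m' / g' for the same germ satisfy g' m = g m' near b,
    hence in M(U) after multiplication by a function that is invertible at b. *)
Lemma germ_value_uniq s q q' : germ_value s q -> germ_value s q' -> q = q'.
Proof.
move=> [W [WU [WV [g [m [Wb g0 mE gq]]]]]] [W' [WU' [WV' [g' [m' [Wb' g0' mE' gq']]]]]].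
pose I := opensI W W'.
have IW : I `<=` W by exact: opensIl.
have IW' : I `<=` W' by exact: opensIr.
have IU : I `<=` U by apply: subset_trans IW WU.
have IV : I `<=` mg_dom s by apply: subset_trans IW WV.
have gg : cgen (dm_mul g' m) = cgen (dm_mul g m').
  apply: (@cgen_eq I IU) => //.
  rewrite !dm_res_mul (fraction_res IU IV IW mE) (fraction_res IU IV IW' mE').
  exact: dm_mulC.
apply: (scalerI (mulf_neq0 g0' g0)).
by rewrite -scalerA gq mulrC -scalerA gq' -!cgen_mul.
Qed.

Lemma germ_value_sec m : germ_value (MGerm Ub m) (cgen m).
Proof.
exists U, (@subset_refl _ U), (@subset_refl _ U), 1, m.
by rewrite !rmorph1 oner_neq0 dm_mul1 scale1r.
Qed.

Lemma germ_value_add (V : opens B) (Vb : opens_set V b) m m' q q' :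
    germ_value (MGerm Vb m) q -> germ_value (MGerm Vb m') q' ->
  germ_value (MGerm Vb (m + m')) (q + q').
Proof.
move=> [W [WU [WV [g [t [Wb g0 mE gq]]]]]].
move=> [W' [WU' [WV' [g' [t' [Wb' g0' mE' gq']]]]]].
pose I := opensI W W'.
have IW : I `<=` W by exact: opensIl.
have IW' : I `<=` W' by exact: opensIr.
have IU : I `<=` U by apply: subset_trans IW WU.
have IV : I `<=` V by apply: subset_trans IW WV.
exists I, IU, IV, (g * g'), (dm_mul g' t + dm_mul g t'); split=> //.
- by rewrite rmorphM; apply: mulf_neq0.
- rewrite !raddfD /= !dm_res_mul (fraction_res IU IV IW mE).
  rewrite (fraction_res IU IV IW' mE') rmorphM dm_mulDr.
  by rewrite !dm_mulM (dm_mulC (ores IU g')).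
- rewrite mgenD !cgen_mul -gq -gq' rmorphM scalerDr !scalerA.
  by rewrite (mulrC (val g')).
Qed.

Lemma germ_value_res (V V' : opens B) (V'V : V' `<=` V) (Vb : opens_set V b)
    (Vb' : opens_set V' b) m q :
  germ_value (MGerm Vb m) q -> germ_value (MGerm Vb' (dm_res M V'V m)) q.
Proof.
move=> [W [WU [WV [g [t [Wb g0 mE gq]]]]]].
pose I := opensI W V'.
have IW : I `<=` W by exact: opensIl.
have IV' : I `<=` V' by exact: opensIr.
have IU : I `<=` U by apply: subset_trans IW WU.
have IV : I `<=` V by apply: subset_trans IW WV.
exists I, IU, IV', g, t; split=> //.
by rewrite (dm_res_comp V'V IV' IV); apply: fraction_res mE.
Qed.

(** The action of D on values of germs is expressed through a D-module structure j,
    as the naive fiber itself is only a vector space. *)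
Lemma germ_value_weyl (W : lmodType (DA n iK)) (j : cfiber -> W)
    (V : opens B) (Vb : opens_set V b) w m q q' :
    injective j -> (forall w m, j (cgen (tens_l _ _ w *: m)) = LK w *: j (cgen m)) ->
    (forall c x, j (c *: x) = RK c *: j x) -> j q' = LK w *: j q ->
    germ_value (MGerm Vb m) q ->
  germ_value (MGerm Vb (tens_l _ _ w *: m)) q'.
Proof.
move=> jI jw jr q'E [V' [V'U [V'V [g [t [Vb' g0 mE gq]]]]]].
exists V', V'U, V'V, g, (tens_l _ _ w *: t); split=> //.
  by rewrite !dm_res_weyl mE dm_mul_weyl.
by apply: jI; rewrite jw -gq !jr q'E !scalerA tens_lr_comm.
Qed.

Lemma germ_value_mul (V : opens B) (Vb : opens_set V b) (s : O V) m q :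
    germ_value (MGerm Vb m) q ->
  germ_value (MGerm Vb (dm_mul s m)) (ev Vb s *: q).
Proof.
move=> [W [WU [WV [g [t [Wb g0 mE gq]]]]]].
have [W' [WU' [WV' [g' [s' [Wb' g0' sE]]]]]] := function_fraction s Vb.
have sb : val s' = val g' * ev Vb s.
  have := congr1 (ev Wb') sE; rewrite rmorphM.
  by rewrite !(ev_res _ Ub) (ev_res _ Vb).
pose I := opensI W W'.
have IW : I `<=` W by exact: opensIl.
have IW' : I `<=` W' by exact: opensIr.
have IU : I `<=` U by apply: subset_trans IW WU.
have IV : I `<=` V by apply: subset_trans IW WV.
have sE' : ores IU s' = ores IU g' * ores IV s.
  rewrite -(res_comp WU' IW' IU) sE rmorphM.
  by rewrite (res_comp WU' IW' IU) (res_comp WV' IW' IV).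
exists I, IU, IV, (g * g'), (dm_mul s' t); split=> //.
- by rewrite rmorphM; apply: mulf_neq0.
- rewrite !dm_res_mul (fraction_res IU IV IW mE) sE' rmorphM -!dm_mulM.
  by congr dm_mul; rewrite mulrC -!mulrA; congr (_ * _); rewrite mulrC mulrA.
- rewrite cgen_mul -gq sb rmorphM [LHS]scalerA [RHS]scalerA; congr (_ *: _).
  by rewrite -mulrA mulrC.
Qed.

(* F stands for the fiber of M at b, known through its universal property. *)
Section Fiber.
Variables (F : lmodType (DA n iK)).
Variable fg : forall V : opens B, opens_set V b -> dm_sec M V -> F.
Hypothesis fgZ : forall V (Vb : opens_set V b) a m,
  fg Vb (a *: m) = DA_map n (evE Vb) a *: fg Vb m.
Hypothesis fg_res : forall (V W : opens B) (WV : W `<=` V) (Vb : opens_set V b)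
  (Wb : opens_set W b) m, fg Wb (dm_res M WV m) = fg Vb m.
Hypothesis F_ind : forall P : F -> Prop,
    (forall V (Vb : opens_set V b) m, P (fg Vb m)) ->
    (forall x y, P x -> P y -> P (x + y)) -> (forall d x, P x -> P (d *: x)) ->
  forall x, P x.
Hypothesis F_lift : forall (W : lmodType (DA n iK))
    (g : forall V : opens B, opens_set V b -> dm_sec M V -> W),
    (forall V (Vb : opens_set V b), {morph g V Vb : m m' / m + m'}) ->
    (forall V (Vb : opens_set V b) a m,
       g V Vb (a *: m) = DA_map n (evE Vb) a *: g V Vb m) ->
    (forall (V W : opens B) (WV : W `<=` V) (Vb : opens_set V b)
       (Wb : opens_set W b) m, g W Wb (dm_res M WV m) = g V Vb m) ->
  exists h : {linear F -> W}, forall V (Vb : opens_set V b) m,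
    h (fg Vb m) = g V Vb m.

Let fg_mul (V : opens B) (Vb : opens_set V b) f m :
  fg Vb (dm_mul f m) = RK (ev Vb f) *: fg Vb m.
Proof. by rewrite dm_mul_tens fgZ; congr (_ *: _); apply: tens_lift_r. Qed.

Let fg_weyl (V : opens B) (Vb : opens_set V b) w m :
  fg Vb (tens_l _ _ w *: m) = LK w *: fg Vb m.
Proof. by rewrite fgZ; congr (_ *: _); apply: tens_lift_l. Qed.

(** In the fiber, a germ is a K-multiple of a section over U, and the span of the
    sections over U is stable under D because M(U) is. *)
Lemma chart_spanP (x : F) : scal_span (fg Ub) x.
Proof.
have spanZ d : forall y, scal_span (fg Ub) y -> scal_span (fg Ub) (d *: y).
  move: d; apply: tens_ind => [w|c|d d' dP dP'|d d' dP dP'] y ys.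
  - elim: ys => [m|x1 x2 _ s1 _ s2|c x1 _ s1].
    + by rewrite -fg_weyl; constructor.
    + by rewrite scalerDr; constructor.
    + by rewrite scalerA tens_lr_comm -scalerA; constructor.
  - exact: scal_spanZ.
  - by rewrite scalerDl; constructor; [apply: dP|apply: dP'].
  - by rewrite -scalerA; apply/dP/dP'.
move: x; apply: F_ind => [V Vb m|x y sx sy|d x sx]; last exact: spanZ.
  have [W [WU [WV [g [m' [Wb g0 mE]]]]]] := section_fraction m Vb.
  have gm : RK (val g) *: fg Vb m = fg Ub m'.
    by rewrite -(fg_res WV Vb Wb) -(fg_res WU Ub Wb) mE fg_mul (ev_res WU Ub).
  have -> : fg Vb m = RK (val g)^-1 *: fg Ub m'.
    by rewrite -gm scalerA -rmorphM mulVf // rmorph1 scale1r.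
  exact/scal_spanZ/scal_span_gen.
exact: scal_spanD.
Qed.

(** Taking values of germs is linear over the sections of D (x) O, as seen on the
    generators of that ring, so it extends to the whole fiber. *)
Lemma fiber_to_mfiber :
  exists h : F -> cfiber, [/\ {morph h : x y / x + y},
    forall c x, h (RK c *: x) = c *: h x & forall m, h (fg Ub m) = cgen m].
Proof.
have [W [j [jD [ji jK iK'] jw jr]]] := mfiber_module (evE Ub) (dm_sec M U).
have /choice[G GP] := germ_value_ex.
have GE s q : germ_value s q -> G s = q.
  by move=> sq; apply: germ_value_uniq (GP s) sq.
have GZ (V : opens B) (Vb : opens_set V b) (a : DO n V) : forall m,
    j (G (MGerm Vb (a *: m))) = DA_map n (evE Vb) a *: j (G (MGerm Vb m)).
  move: a; apply: tens_ind => [w|s|a a' aG aG'|a a' aG aG'] m.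
  - rewrite (GE _ (ji (LK w *: j (G (MGerm Vb m))))) ?iK'.
      by congr (_ *: _); apply/esym/tens_lift_l.
    by apply: germ_value_weyl (can_inj jK) jw jr _ (GP _); rewrite iK'.
  - rewrite -dm_mul_tens (GE _ _ (germ_value_mul s (GP (MGerm Vb m)))) jr.
    by congr (_ *: _); apply/esym/tens_lift_r.
  - rewrite scalerDl (GE _ _ (germ_value_add (GP (MGerm Vb (a *: m))) (GP _))).
    by rewrite jD aG aG' rmorphD scalerDl.
  - by rewrite -scalerA aG aG' scalerA rmorphM.
have [||| h hE] := @F_lift W (fun V Vb m => j (G (MGerm Vb m))).
- by move=> V Vb m m'; rewrite -jD; congr j; apply/GE/germ_value_add; apply: GP.
- exact: GZ.
- by move=> V V' V'V Vb Vb' m; congr j; apply/GE/germ_value_res/GP.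
exists (fun x => ji (h x)); split.
- by move=> x y; apply: (can_inj jK); rewrite jD !iK' raddfD.
- by move=> c x; apply: (can_inj jK); rewrite jr !iK' linearZ.
- by move=> m; rewrite hE jK; apply/GE/germ_value_sec.
Qed.

End Fiber.

End AtPoint.
End AffineCharts.

(** * The generic part of a fiber *)

Section GenericFiber.
Variables (n : nat) (k : fieldType) (A : comPzRingType) (iA : {rmorphism k -> A}).
Variables (K : fieldType) (iK : {rmorphism k -> K}) (val : {rmorphism A -> K}).
Hypothesis valE : forall c, val (iA c) = iK c.

Local Notation LA := (tens_l (@weyl_scal n k) iA).
Local Notation RA := (tens_r (@weyl_scal n k) iA).
Local Notation LK := (tens_l (@weyl_scal n k) iK).
Local Notation RK := (tens_r (@weyl_scal n k) iK).
Local Notation frac := (@FracField.tofrac (mpoly n _)).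

Lemma polyK_DAC c : polyK_DA n iK (mpolyC n c) = RK c.
Proof. exact: poly_evalC. Qed.

Lemma polyK_DAX i : polyK_DA n iK (mpolyX K (mnm1 i)) = LK (weyl_X k i).
Proof. exact: poly_evalX. Qed.

Lemma polyK_DA_map p : polyK_DA n iK (map_mpoly iK p) = LK (poly_D n k p).
Proof.
elim/mpoly_subring_ind: p => [c|i|p q pE qE|p q pE qE].
- by rewrite map_mpolyC polyK_DAC poly_DC tens_baseE.
- by rewrite map_mpolyX polyK_DAX; congr LK; apply/esym/poly_evalX.
- by rewrite !rmorphD /= pE qE.
- by rewrite !rmorphM /= pE qE.
Qed.

(* F is the fiber of N at the point val of A: it is spanned over K by the image of
   N, and maps back to the naive fiber K (x)_A N. *)
Variable N : lmodType (DA n iA).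
Variables (F : lmodType (DA n iK)) (u : N -> F).
Hypothesis uD : {morph u : m m' / m + m'}.
Hypothesis uZ : forall a m, u (a *: m) = DA_map n valE a *: u m.
Hypothesis u_span : forall x, scal_span u x.
Hypothesis to_mfiber : exists h : F -> mfiber val N,
  [/\ {morph h : x y / x + y}, forall c x, h (RK c *: x) = c *: h x
    & forall m, h (u m) = mgen val m].

Variable phi : {rmorphism ratfunA n iA -> ratfun n K}.
Hypothesis phi_l : forall p,
  phi (tens_l (ratfun_const n k) iA (frac p)) = frac (map_mpoly iK p).
Hypothesis phi_r : forall a,
  phi (tens_r (ratfun_const n k) iA a) = frac (mpolyC n (val a)).

Local Notation V :=
  (extend (@FracField.tofrac (mpoly n K)) (Defs.restrict F (polyK_DA n iK))).
Local Notation E := (extend phi (generic N)).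

Let vgen (x : F) : V :=
  egen (@FracField.tofrac (mpoly n K)) (x : Defs.restrict F (polyK_DA n iK)).
Let gen (m : N) : generic N :=
  egen (polyA_ratfunA n iA) (m : Defs.restrict N (polyA_DA n iA)).

Let vgenD : {morph vgen : x y / x + y}. Proof. by move=> x y; apply: egenD. Qed.
Let vgenZ p x : vgen (polyK_DA n iK p *: x) = frac p *: vgen x.
Proof. exact: egenZ. Qed.
Let genD : {morph gen : x y / x + y}. Proof. by move=> x y; apply: egenD. Qed.
Let genZ a m : gen (polyA_DA n iA a *: m) = polyA_ratfunA n iA a *: gen m.
Proof. exact: egenZ. Qed.

Let poly_l p : polyA_DA n iA (tens_l _ _ p) = LA (poly_D n k p).
Proof. exact: tens_lift_l. Qed.
Let poly_r a : polyA_DA n iA (tens_r _ _ a) = RA a.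
Proof. exact: tens_lift_r. Qed.
Let rat_l p : polyA_ratfunA n iA (tens_l _ _ p) = tens_l _ _ (frac p).
Proof. exact: tens_lift_l. Qed.
Let rat_r a : polyA_ratfunA n iA (tens_r _ _ a) = tens_r _ _ a.
Proof. exact: tens_lift_r. Qed.

Let u_l w m : u (LA w *: m) = LK w *: u m.
Proof. by rewrite uZ; congr (_ *: _); apply: tens_lift_l. Qed.
Let u_r a m : u (RA a *: m) = RK (val a) *: u m.
Proof. by rewrite uZ; congr (_ *: _); apply: tens_lift_r. Qed.

(** Semilinearity along phi is inherited from linearity over k[x] (x) A, from which
    both modules are extended, and is checked on the generators of that ring. *)
Lemma generic_to_fiber : exists alpha : generic N -> V,
  [/\ {morph alpha : x y / x + y}, forall s x, alpha (s *: x) = phi s *: alpha x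
    & forall m, alpha (gen m) = vgen (u m)].
Proof.
have gZ a m : vgen (u (polyA_DA n iA a *: m)) =
    phi (polyA_ratfunA n iA a) *: vgen (u m).
  move: a m; apply: tens_ind => [p|a|a a' aP aP'|a a' aP aP'] m.
  - by rewrite poly_l rat_l u_l -polyK_DA_map vgenZ phi_l.
  - by rewrite poly_r rat_r u_r -polyK_DAC vgenZ phi_r.
  - by rewrite !rmorphD scalerDl uD vgenD aP aP' scalerDl.
  - by rewrite !rmorphM -scalerA aP aP' scalerA.
have [m m'|a m|alpha alphaE] := @extend_lift _ _ (polyA_ratfunA n iA)
  (Defs.restrict N (polyA_DA n iA)) (Defs.restrict V phi) (fun m => vgen (u m)).
- by rewrite uD vgenD.
- exact: gZ.
exists alpha; split=> [|s x|m]; [exact: raddfD| |exact: alphaE].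
by rewrite [LHS]linearZ.
Qed.

(** The inverse K(x) (x) F -> K(x) (x)_S N(x) comes from F -> K (x)_A N -> K(x) (x)_S
    N(x). That this composite respects multiplication by the x_i is checked on the
    image of N, which spans F over K. *)
Lemma fiber_to_generic : exists beta : V -> E,
  [/\ {morph beta : x y / x + y}, forall c x, beta (c *: x) = c *: beta x
    & forall m, beta (vgen (u m)) = egen phi (gen m)].
Proof.
have [h [hD hZ hu]] := to_mfiber.
have [m m'|a m|d dE] := @extend_lift _ _ val (Defs.restrict N RA)
  (Defs.restrict E (ratfun_const n K)) (fun m => egen phi (gen m)).
- by rewrite genD egenD.
- have -> : gen (a *: m) = gen (RA a *: (m : N)) by [].
  by rewrite -poly_r genZ rat_r egenZ phi_r.
have dZ c x : d (c *: x) = frac (mpolyC n c) *: (d x : E) by rewrite linearZ.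
pose e (x : F) : E := d (h x).
have eD : {morph e : x y / x + y} by move=> x y; rewrite /e hD raddfD.
have eu m : e (u m) = egen phi (gen m) by rewrite /e hu dE.
have eC c x : e (RK c *: x) = frac (mpolyC n c) *: e x by rewrite /e hZ dZ.
have eX i x : e (LK (weyl_X k i) *: x) = frac (mpolyX K (mnm1 i)) *: e x.
  elim: {x}(u_span x) => [m|x y _ xP _ yP|c x _ xP].
  - rewrite -u_l !eu.
    have <- : poly_D n k (mpolyX k (mnm1 i)) = weyl_X k i by apply: poly_evalX.
    by rewrite -poly_l genZ rat_l egenZ phi_l map_mpolyX.
  - by rewrite scalerDr !eD xP yP scalerDr.
  - by rewrite scalerA tens_lr_comm -scalerA !eC xP !scalerA mulrC.
have eP p x : e (polyK_DA n iK p *: x) = frac p *: e x.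
  elim/mpoly_subring_ind: p x => [c|i|p q pP qP|p q pP qP] x.
  - by rewrite polyK_DAC.
  - by rewrite polyK_DAX.
  - by rewrite !rmorphD !scalerDl eD pP qP.
  - by rewrite !rmorphM -!scalerA pP qP.
have [||beta betaE] := @extend_lift _ _ (@FracField.tofrac (mpoly n K))
  (Defs.restrict F (polyK_DA n iK)) E e.
- exact: eD.
- exact: eP.
exists beta; split=> [x y|c x|m]; [exact: raddfD|by rewrite [LHS]linearZ|].
by rewrite betaE eu.
Qed.

(** Composing to K(x) (x) F and back is n |-> 1 (x) n, so a relation between the
    images of the v_i in K(x) (x) F is one in K(x) (x)_S N(x), to which
    [extend_relations] applies. *)
Lemma fiber_rank (R : realType) r (v : 'I_r -> generic N) : generates v ->
  exists t (T : 'M[ratfunA n iA]_(t, r)), [/\ forall i, lincomb v (row i T) = 0,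
      forall c, lincomb v c = 0 -> (map_mx phi c <= map_mx phi T)%MS
    & holonomic_rank R F = ((r - \rank (map_mx phi T))%N%:R)%:E].
Proof.
move=> genv; have [t [T [relT maxT relE]]] := extend_relations phi genv.
exists t, T; split=> //.
have [alpha [aD aZ au]] := generic_to_fiber.
have [beta [bD bZ bu]] := fiber_to_generic.
have a0 : alpha 0 = 0 by apply: (addIr (alpha 0)); rewrite -aD !add0r.
have b0 : beta 0 = 0 by apply: (addIr (beta 0)); rewrite -bD !add0r.
have ba x : beta (alpha x) = egen phi x.
  move: x; apply: extend_ind => [m|x y xP yP|s x xP].
  - by rewrite -[egen _ m]/(gen m) au bu.
  - by rewrite aD bD xP yP egenD.
  - by rewrite aZ bZ xP egenZ.
pose w i := alpha (v i).
have aE c : alpha (lincomb v c) = lincomb w (map_mx phi c).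
  rewrite /lincomb (big_morph alpha aD a0); apply: eq_bigr => i _.
  by rewrite aZ mxE.
apply: (@dimension_relations R _ V r t w).
  apply: extend_ind => [x|x y [c ->] [d ->]|a x [c ->]].
  - elim: {x}(u_span x) => [m|x y _ [c xE] _ [d yE]|c x _ [d xE]].
    + have [c mE] := genv (gen m); exists (map_mx phi c).
      by rewrite -aE -mE au.
    + exists (c + d); rewrite lincombD -[lincomb w c]xE -[lincomb w d]yE.
      exact: vgenD.
    + exists (frac (mpolyC n c) *: d); rewrite lincombZ -xE -polyK_DAC.
      exact: vgenZ.
  - by exists (c + d); rewrite lincombD.
  - by exists (a *: c); rewrite lincombZ.
move=> c; split=> [wc|/submxP[d ->]].
  apply: relE; have := congr1 beta wc; rewrite b0 => <-.
  rewrite /lincomb (big_morph beta bD b0); apply: eq_bigr => i _.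
  by rewrite bZ ba.
rewrite mulmx_sum_row raddf_sum big1 // => i _ /=.
by rewrite lincombZ -map_row -aE relT a0 scaler0.
Qed.

End GenericFiber.

(** * Specialization of rational functions *)

Section Specialization.
Variables (n : nat) (k : fieldType) (A : comPzRingType) (iA : {rmorphism k -> A}).

Local Notation frac := (@FracField.tofrac (mpoly n _)).

(** Evaluation of the coefficients, k(x) (x) A -> K(x), at a K-point of A. *)
Definition is_specialization (K : fieldType) (iK : {rmorphism k -> K})
    (val : {rmorphism A -> K}) (phi : {rmorphism ratfunA n iA -> ratfun n K}) :=
  (forall p, phi (tens_l (ratfun_const n k) iA (frac p)) = frac (map_mpoly iK p)) /\
  (forall a, phi (tens_r (ratfun_const n k) iA a) = frac (mpolyC n (val a))).

(** Nonzero polynomials over k stay nonzero over K, so fractions can be mapped. *)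
Lemma specialization (K : fieldType) (iK : {rmorphism k -> K})
    (val : {rmorphism A -> K}) : (forall c, val (iA c) = iK c) ->
  exists phi, is_specialization iK val phi.
Proof.
move=> valE.
pose g : {rmorphism mpoly n k -> ratfun n K} :=
  (@FracField.tofrac (mpoly n K) \o map_mpoly iK)%FUN.
have [p /eqP gp0|h hE] := fraction_lift (g := g).
  move: gp0; rewrite tofrac_eq0 => /eqP gp0; apply/mpolyP => m.
  apply: (fmorph_inj iK); rewrite -mcoeff_map_mpoly [map_mpoly iK p]gp0.
  by rewrite !mcoeff0 rmorph0.
pose r : {rmorphism A -> ratfun n K} := (ratfun_const n K \o val)%FUN.
have hr a b : h a * r b = r b * h a by rewrite mulrC.
have hr0 c : h (ratfun_const n k c) = r (iA c).
  by rewrite /= valE hE /= map_mpolyC.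
exists (tens_lift hr hr0); split=> [p|a].
  by rewrite tens_lift_l hE.
by rewrite tens_lift_r.
Qed.

Section Openness.
Variables (I : Type) (K : I -> fieldType) (iK : forall i, {rmorphism k -> K i}).
Variable val : forall i, {rmorphism A -> K i}.
Hypothesis valE : forall i c, val i (iA c) = iK i c.
Variable phi : forall i, {rmorphism ratfunA n iA -> ratfun n (K i)}.
Hypothesis phiP : forall i, is_specialization (iK i) (val i) (phi i).

(** These are the families induced by a polynomial over A, which is kept as the
    function of its coefficients since the type of A includes the zero ring. *)
Definition poly_family (q : forall i, mpoly n (K i)) :=
  exists F : multinom n -> A, forall i m, mcoeff m (q i) = val i (F m).

Lemma poly_familyD q q' : poly_family q -> poly_family q' ->
  poly_family (fun i => q i + q' i).
Proof.
move=> [F FE] [F' FE']; exists (fun m => F m + F' m) => i m.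
by rewrite mcoeffD FE FE' rmorphD.
Qed.

Lemma poly_familyM q q' : poly_family q -> poly_family q' ->
  poly_family (fun i => q i * q' i).
Proof.
move=> [F FE] [F' FE'].
exists (fun m => \sum_(j : bmultinom n (mdeg m).+1 * bmultinom n (mdeg m).+1
  | m == mnm_add j.1 j.2) F j.1 * F' j.2) => i m.
rewrite mcoeffM rmorph_sum; apply: eq_bigr => j _.
by rewrite FE FE' rmorphM.
Qed.

Lemma poly_family_map p : poly_family (fun i => map_mpoly (iK i) p).
Proof. by exists (fun m => iA (mcoeff m p)) => i m; rewrite mcoeff_map_mpoly valE. Qed.

Lemma poly_family_const a : poly_family (fun i => mpolyC n (val i a)).
Proof.
exists (fun m => if m == mnm0 then a else 0) => i m.
by rewrite mcoeffC; case: eqP; rewrite ?mulr1 // mulr0 rmorph0.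
Qed.

(** Every element of k(x) (x) A is, up to a denominator in k[x], a polynomial with
    coefficients in A; it is stated after evaluation at the points. *)
Lemma specialization_family (x : ratfunA n iA) :
  exists p q, [/\ p != 0, poly_family q
    & forall i, phi i x * frac (map_mpoly (iK i) p) = frac (q i)].
Proof.
have phil i := (phiP i).1; have phir i := (phiP i).2.
move: x; apply: tens_ind => [x|a|x y [p [q [p0 qF qE]]] [p' [q' [p0' qF' qE']]]
                                |x y [p [q [p0 qF qE]]] [p' [q' [p0' qF' qE']]]].
- have [a [b [b0 xE]]] := fractionP x.
  exists b, (fun i => map_mpoly (iK i) a); split=> //; first exact: poly_family_map.
  by move=> i; rewrite -!phil -rmorphM -rmorphM xE.
- exists 1, (fun i => mpolyC n (val i a)); split; first exact: oner_neq0.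
    exact: poly_family_const.
  by move=> i; rewrite phir !rmorph1 mulr1.
- exists (p * p'), (fun i => q i * map_mpoly (iK i) p' + q' i * map_mpoly (iK i) p).
  split; first exact: mulf_neq0.
    by apply: poly_familyD; apply: poly_familyM => //; apply: poly_family_map.
  move=> i; rewrite !rmorphD !rmorphM /= -qE -qE' mulrDl mulrA.
  by congr (_ + _); rewrite mulrA mulrAC.
- exists (p * p'), (fun i => q i * q' i); split; first exact: mulf_neq0.
    exact: poly_familyM.
  by move=> i; rewrite !rmorphM /= -qE -qE' mulrACA.
Qed.

(** A nonzero specialization has a nonzero numerator, some coefficient of which is
    the value of an f in A; where f does not vanish, neither does the numerator. *)
Lemma specialization_open (x : ratfunA n iA) i0 : phi i0 x != 0 ->
  exists f : A, val i0 f != 0 /\ forall i, val i f != 0 -> phi i x != 0.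
Proof.
have [p [q [p0 [F FE] qE]]] := specialization_family x => x0.
have mp0 i : frac (map_mpoly (iK i) p) != 0.
  rewrite tofrac_eq0; apply: contra_neq p0 => mp0; apply/mpolyP => m.
  by apply: (fmorph_inj (iK i)); rewrite -mcoeff_map_mpoly mp0 !mcoeff0 rmorph0.
have qi0 : q i0 != 0.
  by have := mulf_neq0 x0 (mp0 i0); rewrite qE tofrac_eq0.
have [m qm0] : exists m, mcoeff m (q i0) != 0.
  apply: contrapT => nq; case/eqP: qi0; apply/mpolyP => m; rewrite mcoeff0.
  by apply/eqP/negPn/negP => qm; apply: nq; exists m.
exists (F m); split=> [|i]; first by rewrite -FE.
rewrite -FE; apply: contra_neq => xi0; apply/eqP.
have : frac (q i) == 0 by rewrite -qE xi0 mul0r.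
by rewrite tofrac_eq0 => /eqP ->; rewrite mcoeff0.
Qed.

End Openness.
End Specialization.

(** * Semi-continuity of the rank *)

Section Rank.
Variables (n : nat) (k : fieldType) (B : scheme k) (M : DO_module n B).

Local Notation O := (sec (lrs_sheaf B)).

Section Fiber.
Variable b : B.

Local Notation frel := (@fiber_rel n k B M b).

Let fgen (V : opens B) (Vb : opens_set V b) (m : dm_sec M V) : fiber M b :=
  pres_mod_gen _ (MGerm Vb m).

Let fgenD (V : opens B) (Vb : opens_set V b) : {morph fgen Vb : m m' / m + m'}.
Proof.
move=> m m'; rewrite -[RHS](@zclsD (pres_mod_setoid frel)).
by apply: (@pres_mod_rel _ _ frel); constructor.
Qed.

Let fgenZ (V : opens B) (Vb : opens_set V b) a m :
  fgen Vb (a *: m) = DA_map n (value_struct Vb) a *: fgen Vb m.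
Proof.
rewrite -[RHS](@mclsZ _ (pres_mod_setoid frel)).
by apply: (@pres_mod_rel _ _ frel); constructor.
Qed.

Let fgen_res (V W : opens B) (WV : W `<=` V) (Vb : opens_set V b)
  (Wb : opens_set W b) m : fgen Wb (dm_res M WV m) = fgen Vb m.
Proof. by apply/esym/(@pres_mod_rel _ _ frel); constructor. Qed.

Let fiber_ind (P : fiber M b -> Prop) :
    (forall V (Vb : opens_set V b) m, P (fgen Vb m)) ->
    (forall x y, P x -> P y -> P (x + y)) -> (forall d x, P x -> P (d *: x)) ->
  forall x, P x.
Proof.
move=> Pg PD PZ; apply: pres_mod_ind => // [[V Vb m]|]; first exact: Pg.
by rewrite -(scale0r (@fgen (opensT B) I 0)); apply: PZ.
Qed.

Let fiber_lift (W : lmodType (DA n (kappa_str b)))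
    (g : forall V : opens B, opens_set V b -> dm_sec M V -> W) :
    (forall V (Vb : opens_set V b), {morph g V Vb : m m' / m + m'}) ->
    (forall V (Vb : opens_set V b) a m,
       g V Vb (a *: m) = DA_map n (value_struct Vb) a *: g V Vb m) ->
    (forall (V W : opens B) (WV : W `<=` V) (Vb : opens_set V b)
       (Wb : opens_set W b) m, g W Wb (dm_res M WV m) = g V Vb m) ->
  exists h : {linear fiber M b -> W}, forall V (Vb : opens_set V b) m,
    h (fgen Vb m) = g V Vb m.
Proof.
move=> gD gZ gr.
have [t u tu|h hE] := @pres_mod_lift _ _ frel W
  (fun s => g (mg_dom s) (mg_mem s) (mg_sec s)).
  case: tu => [V Vb m m'|V Vb a m|V V' V'V Vb Vb' m]; [exact: gD|exact: gZ|].
  exact/esym/gr.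
by exists h => V Vb m; rewrite hE.
Qed.

Variables (U : opens B) (affU : is_affine U) (qcU : quasicoherent_on M U).
Variable Ub : opens_set U b.
Variable phi : {rmorphism ratfunA n (struct_map U) -> ratfun n (kappa b)}.
Hypothesis phiP : is_specialization (kappa_str b) (value Ub) phi.

(** [fiber_rank] at a point b of the chart, the residue field being evaluated as
    in [value]. *)
Lemma rank_chart (R : realType) r (v : 'I_r -> generic (dm_sec M U)) :
    generates v ->
  exists t (T : 'M[ratfunA n (struct_map U)]_(t, r)),
    [/\ forall i, lincomb v (row i T) = 0,
      forall c, lincomb v c = 0 -> (map_mx phi c <= map_mx phi T)%MS
    & rank M R b = ((r - \rank (map_mx phi T))%N%:R)%:E].
Proof.
move=> genv; have [phi_l phi_r] := phiP.
have ev_res (V W : opens B) (WV : W `<=` V) (Vb : opens_set V b)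
  (Wb : opens_set W b) s := value_res WV Vb Wb s.
have basisU W := @affine_basis _ _ _ affU b Ub W.
have span := @chart_spanP _ _ _ M U qcU b Ub (kappa b) (kappa_str b)
  (fun V Vb => value Vb) (fun V Vb => value_struct Vb) ev_res basisU
  (fiber M b) fgen fgenZ fgen_res fiber_ind.
have to_mfiber := @fiber_to_mfiber _ _ _ M U affU qcU b Ub (kappa b)
  (kappa_str b) (fun V Vb => value Vb) (fun V Vb => value_struct Vb) ev_res basisU
  (fiber M b) fgen fiber_lift.
exact: (@fiber_rank n k _ (struct_map U) (kappa b) (kappa_str b) (value Ub)
  (value_struct Ub) (dm_sec M U) (fiber M b) (fgen Ub) (fgenD Ub) (fgenZ Ub)
  span to_mfiber phi phi_l phi_r R r v genv).
Qed.

End Fiber.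

(** Relations T of maximal rank at b0 have a nonzero minor there; where that minor
    stays nonzero, T has at least the same rank, and the relations T' of maximal rank
    at b have no smaller one. *)
Lemma rank_le_near (R : realType) (U : opens B) (b0 : B) :
    is_affine U -> quasicoherent_on M U -> fin_gen (generic (dm_sec M U)) ->
    opens_set U b0 ->
  exists d (W : opens B), [/\ opens_set W b0, rank M R b0 = (d%:R)%:E
    & forall b, opens_set W b -> exists2 e, (e <= d)%N & rank M R b = (e%:R)%:E].
Proof.
move=> affU qcU [r [v genv']] Ub0.
have genv : generates v.
  move=> x; have [c ->] := genv' x; exists (\row_i c i).
  by apply: eq_bigr => i _; rewrite mxE.
pose point := {b : B & opens_set U b}.
pose phi (i : point) := projT1 (cid (specialization n (value_struct (projT2 i)))).
have phiP (i : point) :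
    is_specialization (kappa_str (projT1 i)) (value (projT2 i)) (phi i).
  exact: projT2 (cid _).
pose p0 : point := existT _ b0 Ub0.
have [t [T [relT maxT rk0]]] := rank_chart affU qcU (phiP p0) R genv.
have [f [g minor]] := rank_minor (map_mx (phi p0) T).
rewrite -map_mxsub det_map_mx in minor.
have [a [a0 aP]] := specialization_open (fun i : point => value_struct (projT2 i))
  phiP minor.
exists (r - \rank (map_mx (phi p0) T))%N, (nonvanishing a); split=> //.
  by exists Ub0.
move=> b [Ub ab]; pose p : point := existT _ b Ub.
have [t' [T' [relT' maxT' rk]]] := rank_chart affU qcU (phiP p) R genv.
exists (r - \rank (map_mx (phi p) T'))%N => //; apply: leq_sub2l.
have : \det (mxsub f g (map_mx (phi p) T)) != 0.
  by rewrite -map_mxsub det_map_mx; apply: (aP p).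
move/minor_rank/leq_trans; apply; apply: mxrankS.
by apply/row_subP => i; rewrite -map_row; apply: maxT'.
Qed.

End Rank.

Theorem theorem2p6 (R : realType) (n : nat) (B : scheme R[i])
    (hB : noetherian_scheme B) (M : DO_module n B) (hM : holonomic_family M) :
  [/\ upper_semicontinuous (fun b : B => rank M R b),
      upper_semicontinuous (fun b : rational_points B => rank M R (set_val b))
    & closed [set b : rational_points B | rank_jumping M R (set_val b)]].
Proof.
have near (b0 : B) : exists d (W : opens B),
    [/\ opens_set W b0, rank M R b0 = (d%:R)%:E
      & forall b, opens_set W b -> exists2 e, (e <= d)%N & rank M R b = (e%:R)%:E].
  have [[qc _] _ fgM] := hM; have [U [Ub affU qcU]] := qc b0.
  exact: rank_le_near affU qcU (fgM U affU) Ub.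
have le_near (b0 : B) : exists W : opens B, opens_set W b0 /\
    forall b, opens_set W b -> (rank M R b <= rank M R b0)%E.
  have [d [W [Wb0 -> le_d]]] := near b0; exists W; split=> // b /le_d[e ed ->].
  by rewrite lee_fin ler_nat.
have usc : upper_semicontinuous (fun b : B => rank M R b).
  move=> b0 a b0a; have [W [Wb0 le_b0]] := le_near b0.
  exists W; first by apply: open_nbhs_nbhs; split=> //; apply: opens_open.
  by move=> b /le_b0 bb0; apply: le_lt_trans b0a.
have preim_nbhs (b : rational_points B) (V : set B) : nbhs (set_val b) V ->
    nbhs b (set_val @^-1` V).
  by move=> bV; apply: initial_continuous.
split=> //.
  move=> b a /usc[V bV Va]; exists (set_val @^-1` V); first exact: preim_nbhs.
  by move=> c; apply: Va.
rewrite -[X in closed X]setCK; apply: open_closedC; rewrite openE => b /= not_jump.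
(* b has minimal rank among the rational points of U *)
have [U [oU Ub rk_le]] : exists U : set B, [/\ open U, U (set_val b)
    & forall c, U c -> rational_points B c -> (rank M R (set_val b) <= rank M R c)%E].
  apply: contrapT => nU; apply: not_jump; split=> [|U oU Ub]; first exact: set_valP.
  rewrite ltNge; apply/negP => le_inf; apply: nU; exists U; split=> // c Uc rc.
  by apply: le_trans le_inf _; apply: ereal_inf_lbound; exists c.
have [W [Wb le_b]] := le_near (set_val b).
pose V := U `&` W.
have oV : open V by apply: openI oU _; apply: opens_open.
have rk_V c : V c -> rational_points B c -> rank M R c = rank M R (set_val b).
  by move=> [Uc Wc] rc; apply/eqP; rewrite eq_le le_b // rk_le.
apply: filterS (preim_nbhs b V _); last by apply: open_nbhs_nbhs; split.
move=> c /= Vc [rc /(_ V oV Vc)]; apply/negP; rewrite -leNgt.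
apply: le_ereal_inf_tmp => _ [c' [Vc' rc'] <-].
by rewrite (rk_V _ Vc rc) (rk_V _ Vc' rc').
Qed.
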